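(* Let $\Gamma=\Gamma_p$ for some $1<p\leq 2$, and let $f$ satisfy: (1) $f\in C^1(\Gamma)\cap C^0(\bar{\Gamma})$ is symmetric, i.e. $f(\lambda_1,\lambda_2)=f(\lambda_2,\lambda_1)$; (2) $f$ is homogeneous of degree $1$; (3) $f>0$ and $f_{\lambda_i}:=\frac{\partial f}{\partial\lambda_i}>0$ in $\Gamma$ for $i=1,2$, and $f|_{\partial\Gamma}=0$; (4) $\sum_{i=1}^{2}f_{\lambda_i}\geq\delta$ in $\Gamma$ for some $\delta>0$. Let $K$ be a $C^1$ positive function in $B_r\subset\mathbb{R}^2$, and let $u\in C^3(B_r)$ satisfy $$f(\lambda(A^u))=K,\quad \lambda(A^u)\in\Gamma\quad\text{in }B_r.$$ Then $$|\nabla u|\leq C\quad\text{in }B_{r/2},$$ for some constant $C$ depending only on $r$, $(f,\Gamma)$, and upper bounds of $\sup_{B_r}u$ and $\|K\|_{C^1(B_r)}$.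
   Context: $B_r$ is the open ball of radius $r>0$ centered at the origin in $\mathbb{R}^2$. For $1\le p\le 2$, $\Gamma_p:=\{(\lambda_1,\lambda_2)\in\mathbb{R}^2:\lambda_2>(p-2)\lambda_1,\ \lambda_1>(p-2)\lambda_2\}$. For a $C^2$ function $u$, $$A^u=-\frac{\nabla^2u}{e^u}+\frac{1}{2}\frac{du\otimes du}{e^u}-\frac{1}{4}\frac{|\nabla u|^2}{e^u}I,$$ and $\lambda(A^u)$ denotes the eigenvalues of the symmetric matrix $A^u$. *)

(* Defs.v *)
From HB Require Import structures.
From mathcomp Require Import all_boot all_order all_algebra.
From mathcomp Require Import all_classical all_reals all_analysis.
Set Implicit Arguments.
Unset Strict Implicit.
Unset Printing Implicit Defensive.
Import Order.TTheory GRing.Theory Num.Theory.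
Import numFieldNormedType.Exports.
Local Open Scope classical_set_scope.
Local Open Scope ring_scope.

Section Definitions.
Variable R : realType.
Implicit Types (D A : set 'rV[R]_2) (g u : 'rV[R]_2 -> R) (x l : 'rV[R]_2).

(* The norm `|x| that the library puts on 'rV[R]_2 is the sup norm, hence
   explicit Euclidean norms and balls; the topology is the same. *)
Definition enorm x : R := Num.sqrt (\sum_i x 0 i ^+ 2).

Definition eball (r : R) : set 'rV[R]_2 := [set x | enorm x < r].

Definition partial (i : 'I_2) g : 'rV[R]_2 -> R := 'D_(delta_mx 0 i) g.

Definition grad g x : 'rV[R]_2 := \row_i partial i g x.

Definition hess g x : 'M[R]_2 := \matrix_(i, j) partial i (partial j g) x.

(* g is of class C^k on D; meant for open D, so that the partial derivatives
   at points of D depend only on the values of g on D. *)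
Fixpoint classC (k : nat) D g : Prop :=
  (forall x, D x -> {for x, continuous g}) /\
  (if k is k'.+1 then
     forall i, (forall x, D x -> derivable g x (delta_mx 0 i)) /\
               classC k' D (partial i g)
   else True).

(* sup_D |g| + sup_D |grad g|, possibly +oo *)
Definition normC1 D g : \bar R :=
  (ereal_sup [set `|g x|%:E | x in D] +
   ereal_sup [set (enorm (grad g x))%:E | x in D])%E.

Definition boundary A : set 'rV[R]_2 := closure A `\` interior A.

Definition Gamma (p : R) : set 'rV[R]_2 :=
  [set l | (p - 2) * l 0 0 < l 0 1 /\ (p - 2) * l 0 1 < l 0 0].

Definition Amat u x : 'M[R]_2 :=
  - ((expR (u x))^-1 *: hess u x)
  + (2^-1 / expR (u x)) *: ((grad u x)^T *m grad u x)
  - (4^-1 * enorm (grad u x) ^+ 2 / expR (u x)) *: 1%:M.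

(* l lists the eigenvalues of M with multiplicity; the order is arbitrary *)
Definition eigenvalues_of (M : 'M[R]_2) l : Prop :=
  char_poly M = \prod_i ('X - (l 0 i)%:P).

End Definitions.

(* Main.v *)
Require Import Defs.
From HB Require Import structures.
From mathcomp Require Import all_boot all_order all_algebra.
From mathcomp Require Import all_classical all_reals all_analysis.
From mathcomp Require Import ring lra.
Set Implicit Arguments.
Unset Strict Implicit.
Unset Printing Implicit Defensive.
Import Order.TTheory GRing.Theory Num.Theory.
Import numFieldNormedType.Exports.
Local Open Scope classical_set_scope.
Local Open Scope ring_scope.

(** Put [W = e^u A^u = - D^2 u + du (x) du / 2 - |du|^2 I / 4].  As [f] is
    homogeneous of degree 1, the equation reads [f(eig W) = K e^u], and its
    right-hand side is bounded from above by the given upper bounds.  Let [F]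
    be the derivative of [W |-> f(eig W)]: a positive definite matrix with
    trace [f_1 + f_2 >= delta] and with [F : W = f] by Euler's relation.

    The estimate is a Bernstein argument for [eta |du|], where
    [eta = rho^2 - |x|^2] and [rho = 3r/4].  At a maximum:

    - The first-order condition is [eta D^2u du = 2 |du|^2 x].  So every second
      derivative of [u] with one index in the direction [nu] of [du] is
      [O(r |du| / eta)], which is negligible against [|du|^2] once [eta |du|]
      is large.
    - The second-order condition contracted with [F]
      ([max_point_conditions]), together with the equation differentiated
      along [du] ([derivative_of_equation]), bounds [eta^4 tr(F (D^2u)^2)] by
      [tr F] times a cubic polynomial in [eta |du|]
      ([contracted_inequality]).
    - [tr(F (D^2u)^2) >= c |du|^4 tr F], which is of fourth order
      ([rotated_lower_bound]).  Indeed [W_nu_nu] is almost [|du|^2 / 4] and the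
      off-diagonal entry almost vanishes.  If the tangential second derivative
      [u_tau_tau] were small against [|du|^2], then [W] would be almost
      [|du|^2 / 4 diag(1, -1)], whose eigenvalues [(1, -1)] lie outside the
      closed cone: this is where [p > 1] enters.  And if [F_tau_tau] were small
      against [tr F], then [F : W] would be comparable to [|du|^2 tr F], which
      is much more than [K e^u].

    The quartic and the cubic bound together give a bound for [eta |du|]
    ([growth_contradiction], [bernstein_core]).  The weight does not involve
    [u], which is why the bound depends on [u] only through an upper bound for
    [e^u].

    The function [W |-> f(eig W)] has to be differentiated at the maximum
    only, and there the two eigenvalues are distinct, so they are given by a
    smooth formula: if [W] were a multiple of the identity, Euler's relation
    would make that multiple at most [K e^u / delta], whereas [W_nu_nu] is
    almost [|du|^2 / 4] ([umbilic_excluded]). *)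

(** * Functions of class C^k in the plane *)

Section Differentiability.
Variable R : realType.
Implicit Types (D : set 'rV[R]_2) (g : 'rV[R]_2 -> R) (x v : 'rV[R]_2).

Notation ex := (delta_mx 0 0 : 'rV[R]_2).
Notation ey := (delta_mx 0 1 : 'rV[R]_2).

Lemma ord2 (i : 'I_2) : i = 0 \/ i = 1.
Proof. by case: i => [[|[|//]] Hi]; [left|right]; apply/val_inj. Qed.

Lemma rV2E v : v = v 0 0 *: ex + v 0 1 *: ey.
Proof.
apply/rowP => i; case: (ord2 i) => ->; rewrite !mxE /=; ring.
Qed.

Lemma sum2 (F : 'I_2 -> R) : \sum_i F i = F 0 + F 1.
Proof. by rewrite big_ord_recl big_ord1; congr (_ + F _); apply/val_inj. Qed.

Lemma is_derive_line g x v (s : R) :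
  derivable g (s *: v + x) v ->
  is_derive s (1 : R) (fun h : R => g (h *: v + x)) ('D_v g (s *: v + x)).
Proof.
have E : (fun h : R => h^-1 *: ((g \o shift (s *: v + x)) (h *: v) - g (s *: v + x)))
  = (fun h : R => h^-1 *: (((fun h : R => g (h *: v + x)) \o shift s) (h *: (1 : R))
       - g (s *: v + x))).
  apply/funext => h /=; congr (_ *: (g _ - _)).
  by rewrite [_%:A]mulr1 scalerDl addrA.
move=> dg; split; rewrite /derivable /derive -E //.
Qed.

(** A form of the mean value theorem that needs no case distinction on the
    sign of the increment. *)
Lemma MVT_origin (f df : R -> R) (s : R) :
  (forall t, `|t| <= `|s| -> is_derive t (1 : R) f (df t)) ->
  exists2 t, `|t| <= `|s| & f s - f 0 = s * df t.
Proof.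
move=> fdf.
have cf (a b : R) : (forall t, a <= t <= b -> `|t| <= `|s|) ->
    {within `[a, b], continuous f}.
  move=> ab; apply: derivable_within_continuous => t; rewrite in_itv /= => tab.
  by case: (fdf t (ab t tab)).
have [s0|s0|->] := ltgtP s 0.
- have ab t : s <= t <= 0 -> `|t| <= `|s|.
    by case/andP => ? ?; rewrite !ler0_norm // ?(ltW s0) // lerN2.
  have [t|t tab E] := @MVT _ f df s 0 s0 _ (cf _ _ ab).
    by rewrite in_itv /= => /andP[? ?]; apply: fdf; apply: ab; rewrite !ltW.
  exists t; last by rewrite -opprB E; ring.
  by move: tab; rewrite in_itv /= => /andP[? ?]; apply: ab; rewrite !ltW.
- have ab t : 0 <= t <= s -> `|t| <= `|s| by case/andP => ? ?; rewrite !ger0_norm // ltW.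
  have [t|t tab ->] := @MVT _ f df 0 s s0 _ (cf _ _ ab).
    by rewrite in_itv /= => /andP[? ?]; apply: fdf; apply: ab; rewrite !ltW.
  exists t; last by rewrite subr0 mulrC.
  by move: tab; rewrite in_itv /= => /andP[? ?]; apply: ab; rewrite !ltW.
- by exists 0; rewrite ?normr0 // subrr mul0r.
Qed.

(** The candidate differential, as a bundled linear map. *)
Definition lin2 (p q : R) (h : 'rV[R]_2) : R := h 0 0 * p + h 0 1 * q.

Fact lin2_linear p q : linear (lin2 p q).
Proof. by move=> a u v; rewrite /lin2 !mxE /= /GRing.scale /=; ring. Qed.

HB.instance Definition _ p q :=
  GRing.isLinear.Build R 'rV[R]_2 R _ (lin2 p q) (@lin2_linear p q).

Lemma lin2_continuous p q : continuous (lin2 p q).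
Proof.
have c (i : 'I_2) (r : R) : continuous (fun h : 'rV[R]_2 => h 0 i * r).
  move=> h; apply: (@continuousM R 'rV[R]_2 (fun h => h 0 i) (cst r) h).
    exact: (@coord_continuous R 1 2 0 i h).
  exact: cst_continuous.
move=> h; exact: (@continuousD R R^o 'rV[R]_2 _ _ h (c 0 p h) (c 1 q h)).
Qed.

Lemma le_coord (h : 'rV[R]_2) i : `|h 0 i| <= `|h|.
Proof.
rewrite [leRHS]/Num.norm /= mx_normrE.
by apply/bigmax_geP; right => /=; exists (0, i).
Qed.

Lemma norm2_lt (h : 'rV[R]_2) (d : R) :
  0 < d -> `|h 0 0| < d -> `|h 0 1| < d -> `|h| < d.
Proof.
move=> d0 h0 h1; rewrite [ltLHS]/Num.norm /= mx_normrE.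
apply/bigmax_ltP; split => // -[i j] _ /=; rewrite (ord1 i).
by case: (ord2 j) => ->.
Qed.

Lemma near_box (P : set 'rV[R]_2) x : nbhs x P ->
  exists2 d : R, 0 < d & forall s t, `|s| < d -> `|t| < d -> P (s *: ex + (t *: ey + x)).
Proof.
move=> /nbhs_ballP[d /= d0 dP]; exists d => // s t sd td; apply: dP.
rewrite -ball_normE /ball_ /=; apply: norm2_lt => //; rewrite !mxE /=.
- by rewrite (_ : _ - _ = - s) ?normrN //; ring.
- by rewrite (_ : _ - _ = - t) ?normrN //; ring.
Qed.

(** Reach [h + x] from [x] by a vertical and then a horizontal segment; on each
    of them the mean value theorem replaces the increment by a partial
    derivative at a nearby point, and continuity of the partial derivatives
    finishes the proof. *)
Lemma C1_differentiable D g x : open D -> classC 1 D g -> D x ->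
  differentiable g x /\
  forall v, 'D_v g x = v 0 0 * partial 0 g x + v 0 1 * partial 1 g x.
Proof.
move=> oD [_ gC] Dx.
pose p := partial 0 g x; pose q := partial 1 g x.
have [dg0 [cg0 _]] := gC 0.
have [dg1 [cg1 _]] := gC 1.
have key : g \o shift x = cst (g x) + lin2 p q +o_ (0 : 'rV[R]_2) id.
  apply/eqaddoP => e e_gt0.
  have e20 : 0 < e / 2 by rewrite divr_gt0.
  have nD : nbhs x D by apply: open_nbhs_nbhs.
  have /cvgrPdist_lt/(_ _ e20) n0 := cg0 x Dx.
  have /cvgrPdist_lt/(_ _ e20) n1 := cg1 x Dx.
  have [d d0 dP] := near_box (filterI nD (filterI n0 n1)).
  apply/nbhs_ballP; exists d => //= h; rewrite -ball_normE /ball_ /= sub0r normrN => hd.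
  have h0d := le_lt_trans (le_coord h 0) hd.
  have h1d := le_lt_trans (le_coord h 1) hd.
  pose y := h 0 1 *: ey + x.
  have box s t : `|s| <= `|h 0 0| -> `|t| <= `|h 0 1| ->
     [/\ D (s *: ex + (t *: ey + x)),
         `|p - partial 0 g (s *: ex + (t *: ey + x))| < e / 2 &
         `|q - partial 1 g (s *: ex + (t *: ey + x))| < e / 2].
    move=> sh th; have := dP s t (le_lt_trans sh h0d) (le_lt_trans th h1d).
    by case=> ? [? ?].
  have [s sh E0] : exists2 s, `|s| <= `|h 0 0| &
     g (h 0 0 *: ex + y) - g (0 *: ex + y) = h 0 0 * partial 0 g (s *: ex + y).
    apply: (MVT_origin (f := fun s => g (s *: ex + y))) => s sh.
    by apply: is_derive_line; apply: dg0; case: (box s (h 0 1) sh (lexx _)).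
  have [t th E1] : exists2 t, `|t| <= `|h 0 1| &
     g (h 0 1 *: ey + x) - g (0 *: ey + x) = h 0 1 * partial 1 g (t *: ey + x).
    apply: (MVT_origin (f := fun s => g (s *: ey + x))) => t th.
    apply: is_derive_line; apply: dg1.
    have := box 0 t; rewrite scale0r add0r normr0 normr_ge0 => /(_ isT th).
    by case.
  rewrite scale0r add0r -/y in E0; rewrite scale0r add0r -/y in E1.
  have [_ B0 _] := box s (h 0 1) sh (lexx _).
  have := box 0 t; rewrite scale0r add0r normr0 normr_ge0 => /(_ isT th) [_ _ B1].
  rewrite -/y in B0; rewrite !fctE /=.
  have -> : h + x = h 0 0 *: ex + y by rewrite {1}(rV2E h) /y addrA.
  have -> : g (h 0 0 *: ex + y) - (g x + lin2 p q h) =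
     - (h 0 0 * (p - partial 0 g (s *: ex + y)) + h 0 1 * (q - partial 1 g (t *: ey + x))).
    rewrite (_ : g _ = g x + (g y - g x) + (g (h 0 0 *: ex + y) - g y)); last ring.
    rewrite E0 E1 /lin2; ring.
  rewrite normrN (le_trans (ler_normD _ _)) // !normrM [e in leRHS]splitr mulrDl.
  apply: lerD; rewrite mulrC; apply: ler_pM => //; by [exact: ltW|exact: le_coord].
have dE := diff_unique (@lin2_continuous p q) key.
have dg : differentiable g x.
  by apply/diff_locallyP; rewrite dE; split => //; exact: lin2_continuous.
by split => // v; rewrite deriveE // dE.
Qed.

End Differentiability.

Section Derivatives.
Variable R : realType.
Implicit Types (D : set 'rV[R]_2) (g : 'rV[R]_2 -> R) (x v w : 'rV[R]_2).

Notation ex := (delta_mx 0 0 : 'rV[R]_2).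
Notation ey := (delta_mx 0 1 : 'rV[R]_2).

(** The second difference of [g] over a parallelogram is symmetric in the two
    edges, while this expression of it prescribes the order of
    differentiation; comparing both orders yields [partial_comm]. *)
Lemma iterated_MVT g x v w (s t : R) :
  (forall a b : R, `|a| <= `|s| -> `|b| <= `|t| ->
     derivable g (a *: v + (b *: w + x)) v /\
     derivable ('D_v g) (a *: v + (b *: w + x)) w) ->
  exists a b : R, [/\ `|a| <= `|s|, `|b| <= `|t| &
    g (s *: v + (t *: w + x)) - g (s *: v + x) - (g (t *: w + x) - g x) =
      s * t * 'D_w ('D_v g) (a *: v + (b *: w + x))].
Proof.
move=> dg.
have [a sa Ea] : exists2 a, `|a| <= `|s| &
   (g (s *: v + (t *: w + x)) - g (s *: v + x)) -
   (g (0 *: v + (t *: w + x)) - g (0 *: v + x)) =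
   s * ('D_v g (a *: v + (t *: w + x)) - 'D_v g (a *: v + x)).
  apply: (MVT_origin (f := fun s => g (s *: v + (t *: w + x)) - g (s *: v + x))).
  move=> a sa; apply: is_deriveB; apply: is_derive_line.
    by have [] := dg a t sa (lexx _).
  by have := dg a 0 sa; rewrite normr0 normr_ge0 scale0r add0r => /(_ isT) [].
have [b tb Eb] : exists2 b, `|b| <= `|t| &
   'D_v g (t *: w + (a *: v + x)) - 'D_v g (0 *: w + (a *: v + x)) =
   t * 'D_w ('D_v g) (b *: w + (a *: v + x)).
  apply: (MVT_origin (f := fun t => 'D_v g (t *: w + (a *: v + x)))) => b tb.
  by apply: is_derive_line; rewrite addrCA; have [] := dg a b sa tb.
exists a, b; split; [exact: sa|exact: tb|].
rewrite !scale0r !add0r in Ea Eb.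
have Et : a *: v + (t *: w + x) = t *: w + (a *: v + x) by exact: addrCA.
have Ex : b *: w + (a *: v + x) = a *: v + (b *: w + x) by exact: addrCA.
rewrite Et Eb Ex in Ea.
apply: etrans Ea _.
exact: mulrA.
Qed.

Lemma partial_comm D g x : open D -> classC 2 D g -> D x ->
  partial 0 (partial 1 g) x = partial 1 (partial 0 g) x.
Proof.
move=> oD [_ gC] Dx.
have [dg0 [_ dg0i]] := gC 0; have [dg1 [_ dg1i]] := gC 1.
have [dg01 [cg01 _]] := dg0i 1; have [dg10 [cg10 _]] := dg1i 0.
apply/eqP; rewrite -subr_eq0 -normr_le0; apply/ler_addgt0Pr => e e_gt0.
rewrite add0r.
have e2 : 0 < e / 2 by rewrite divr_gt0.
have nD : nbhs x D by apply: open_nbhs_nbhs.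
have /cvgrPdist_lt/(_ _ e2) n0 := cg01 x Dx.
have /cvgrPdist_lt/(_ _ e2) n1 := cg10 x Dx.
have [d d0 dP] := near_box (filterI nD (filterI n0 n1)).
pose s := d / 2.
have s0 : 0 < s by rewrite divr_gt0.
have sd (a : R) : `|a| <= `|s| -> `|a| < d.
  by move/le_lt_trans; apply; rewrite gtr0_norm // ltr_pdivrMr // ltr_pMr // ltr1n.
have [a [b [sa sb E1]]] : exists a b : R, [/\ `|a| <= `|s|, `|b| <= `|s| &
    g (s *: ex + (s *: ey + x)) - g (s *: ex + x) - (g (s *: ey + x) - g x) =
      s * s * 'D_ey ('D_ex g) (a *: ex + (b *: ey + x))].
  apply: iterated_MVT => a b sa sb.
  have [Dab _] := dP a b (sd _ sa) (sd _ sb).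
  by split; [exact: dg0|exact: dg01].
have [a' [b' [sa' sb' E2]]] : exists a b : R, [/\ `|a| <= `|s|, `|b| <= `|s| &
    g (s *: ey + (s *: ex + x)) - g (s *: ey + x) - (g (s *: ex + x) - g x) =
      s * s * 'D_ex ('D_ey g) (a *: ey + (b *: ex + x))].
  apply: iterated_MVT => a' b' sa' sb'.
  have -> : a' *: ey + (b' *: ex + x) = b' *: ex + (a' *: ey + x) by exact: addrCA.
  have [Dab _] := dP b' a' (sd _ sb') (sd _ sa').
  by split; [exact: dg1|exact: dg10].
have [_ [/= B1 _]] := dP a b (sd _ sa) (sd _ sb).
have [_ [_ /= B2]] := dP b' a' (sd _ sb') (sd _ sa').
have E : partial 1 (partial 0 g) (a *: ex + (b *: ey + x)) =
         partial 0 (partial 1 g) (b' *: ex + (a' *: ey + x)).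
  apply: (mulfI (mulf_neq0 (lt0r_neq0 s0) (lt0r_neq0 s0))).
  have Ex : a' *: ey + (b' *: ex + x) = b' *: ex + (a' *: ey + x) by exact: addrCA.
  have Es : s *: ey + (s *: ex + x) = s *: ex + (s *: ey + x) by exact: addrCA.
  rewrite Ex Es in E2; apply: etrans (esym E1) _; apply: etrans _ E2.
  ring.
have tri (y z c : R) : `|y - c| < e / 2 -> `|z - c| < e / 2 -> `|y - z| <= e.
  move=> yc zc; rewrite (_ : y - z = (y - c) - (z - c)); last by ring.
  apply: le_trans (ler_normB _ _) _; rewrite [leRHS]splitr.
  exact: lerD (ltW yc) (ltW zc).
by rewrite E in B1; exact: tri B2 B1.
Qed.

(** If [c] were positive then [df], which vanishes at [0], would be positive
    just to the right of [0], and [f] would increase there. *)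
Lemma derive2_at_max (f df : R -> R) (c d : R) : 0 < d ->
  (forall t, `|t| < d -> is_derive t (1 : R) f (df t)) ->
  (forall t, `|t| < d -> f t <= f 0) ->
  is_derive (0 : R) (1 : R) df c -> df 0 = 0 /\ c <= 0.
Proof.
move=> d0 fdf fmax dfc.
have itv t : t \in `]- d, d[%R -> `|t| < d by rewrite in_itv /= ltr_norml.
have df0 : df 0 = 0.
  have fd0 : is_derive (0 : R) 1 f 0.
    apply: (@derive1_at_max _ f (- d) d).
    - by rewrite ge0_cp // ltW.
    - by move=> t /itv /fdf [].
    - by rewrite in_itv /= oppr_lt0 d0.
    - by move=> t /itv /fmax.
  have [|_ <-] := fdf 0; first by rewrite normr0.
  by case: fd0.
split => //; rewrite leNgt; apply/negP => c0.
have [G [GE cG G0]] := (is_derive1_caratheodory df 0 c).1 dfc.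
have /cvgrPdist_lt/(_ c c0) /nbhs_ballP[e /= e_gt0 eG'] := cG.
have eG t : ball 0 e t -> 0 < G t.
  by move=> /eG'; rewrite /= G0 ltr_norml => /andP[_]; lra.
pose s := Num.min (d / 2) (e / 2).
have s0 : 0 < s by rewrite lt_min !divr_gt0.
have sd : s < d by rewrite gt_min ltr_pdivrMr // ltr_pMr // ltr1n.
have se : s < e by rewrite gt_min [X in _ || X]ltr_pdivrMr // ltr_pMr // ltr1n // orbT.
have fs t : `|t| <= `|s| -> is_derive t (1 : R) f (df t).
  by move=> ts; apply: fdf; apply: le_lt_trans ts _; rewrite gtr0_norm.
have cf : {within `[0, s], continuous f}.
  apply: derivable_within_continuous => t; rewrite in_itv /= => /andP[t0 ts].
  by case: (fs t); rewrite // !ger0_norm // ltW.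
have [t|t] := @MVT _ f df 0 s s0 _ cf.
  by rewrite in_itv /= => /andP[t0 ts]; apply: fs; rewrite !ger0_norm // ltW.
rewrite in_itv /= subr0 => /andP[t0 ts] E.
have Gt : 0 < G t.
  apply: eG; rewrite -ball_normE /ball_ /= sub0r normrN gtr0_norm //.
  exact: lt_trans ts se.
have := GE t; rewrite df0 !subr0 => dft.
have := fmax s; rewrite gtr0_norm // => /(_ sd).
by rewrite leNgt -subr_gt0 E dft !mulr_gt0.
Qed.

Lemma is_derive_along D g x v (s : R) : open D -> classC 1 D g -> D (s *: v + x) ->
  is_derive s (1 : R) (fun t : R => g (t *: v + x))
    (v 0 0 * partial 0 g (s *: v + x) + v 0 1 * partial 1 g (s *: v + x)).
Proof.
move=> oD gC Dx; have [dg dgE] := C1_differentiable oD gC Dx.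
by rewrite -dgE; apply: is_derive_line; exact: diff_derivable.
Qed.

(** Chain rule for a curve given by its two coordinates, which will be the two
    eigenvalues of [W] along a line. *)
Lemma is_derive_curve D g (a b : R -> R) (s da db : R) :
  open D -> classC 1 D g -> D (a s *: ex + b s *: ey) ->
  is_derive s (1 : R) a da -> is_derive s (1 : R) b db ->
  is_derive s (1 : R) (fun t => g (a t *: ex + b t *: ey))
    (da * partial 0 g (a s *: ex + b s *: ey) +
     db * partial 1 g (a s *: ex + b s *: ey)).
Proof.
move=> oD gC Dx ha hb; have [dg dgE] := C1_differentiable oD gC Dx.
have [/derivable1_diffP dfa ea] := ha; have [/derivable1_diffP dfb eb] := hb.
pose ca t := a t *: ex; pose cb t := b t *: ey.
have dca : differentiable ca s by exact: differentiableZl.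
have dcb : differentiable cb s by exact: differentiableZl.
have dc : differentiable (ca + cb) s by exact: differentiableD.
have dgc : differentiable (g \o (ca + cb)) s by exact: (differentiable_comp dc dg).
have dcE : 'd (ca + cb) s 1 = da *: ex + db *: ey.
  have ea' : 'd a s 1 = da by apply: etrans (esym (deriveE _ dfa)) ea.
  have eb' : 'd b s 1 = db by apply: etrans (esym (deriveE _ dfb)) eb.
  have za : 'd ca s = (fun z => 'd a s z *: ex) :> (R -> _) := diffZl ex dfa.
  have zb : 'd cb s = (fun z => 'd b s z *: ey) :> (R -> _) := diffZl ey dfb.
  have zab : 'd (ca + cb) s = 'd ca s \+ 'd cb s :> (R -> _) := diffD dca dcb.
  apply: etrans (congr1 (fun h => h 1) zab) _.
  apply: etrans (congr2 +%R (congr1 (fun h => h 1) za) (congr1 (fun h => h 1) zb)) _.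
  by move: ea' eb' => /= -> ->.
have dgcE : 'd (g \o (ca + cb)) s 1 = 'd g ((ca + cb) s) (da *: ex + db *: ey).
  have z : 'd (g \o (ca + cb)) s = 'd g ((ca + cb) s) \o 'd (ca + cb) s :> (R -> _) :=
    diff_comp dc dg.
  by apply: etrans (congr1 (fun h => h 1) z) _; rewrite /= dcE.
split; first exact/derivable1_diffP.
apply: etrans (deriveE _ dgc) _; rewrite dgcE.
apply: etrans (esym (deriveE _ dg)) _; rewrite dgE !mxE /=.
by congr (_ * _ + _ * _); ring.
Qed.

Lemma near_eq_partial D g g' x i : open D -> D x -> (forall y, D y -> g y = g' y) ->
  partial i g x = partial i g' x.
Proof.
move=> oD Dx E; apply: near_eq_derive.
by apply: filterS (open_nbhs_nbhs (conj oD Dx)) => y /E.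
Qed.

Lemma classCS k D g : classC k.+1 D g -> classC k D g.
Proof.
elim: k g => [|k IH] g; first by case.
by case=> c C; split; [exact: c|move=> i; have [d Ci] := C i; split; [exact: d|exact: IH]].
Qed.

Lemma classC_subset k D D' g : D' `<=` D -> classC k D g -> classC k D' g.
Proof.
move=> sub; elim: k g => [|k IH] g /=; case=> c C; split=> //.
- by move=> x /sub; exact: c.
- by move=> x /sub; exact: c.
- by move=> i; have [d Ci] := C i; split; [move=> x /sub; exact: d|exact: IH].
Qed.

End Derivatives.

Section OneVariable.
Variable R : realType.
Implicit Types (D : set 'rV[R]_2) (g : 'rV[R]_2 -> R) (x v : 'rV[R]_2).

Lemma near_line D x v : open D -> D x -> \forall t \near (0 : R), D (t *: v + x).
Proof.
move=> oD Dx.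
have c : {for (0 : R), continuous (fun t : R => t *: v + x)}.
  apply: (@continuousD R 'rV[R]_2 R (fun t => t *: v) (cst x) 0).
    exact: scalel_continuous.
  exact: cst_continuous.
by apply: c; rewrite /= scale0r add0r; apply: open_nbhs_nbhs.
Qed.

Lemma is_derive_line0 g x v : derivable g x v ->
  is_derive (0 : R) (1 : R) (fun h : R => g (h *: v + x)) ('D_v g x).
Proof.
have E : x = 0 *: v + x by rewrite scale0r add0r.
by rewrite {1 3}E; exact: is_derive_line.
Qed.

Lemma is_derive_mul (a b : R -> R) (s da db : R) :
  is_derive s (1 : R) a da -> is_derive s (1 : R) b db ->
  is_derive s (1 : R) (fun t => a t * b t) (a s * db + b s * da).
Proof. by move=> ha hb; exact: is_deriveM. Qed.

Lemma is_derive_add (a b : R -> R) (s da db : R) :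
  is_derive s (1 : R) a da -> is_derive s (1 : R) b db ->
  is_derive s (1 : R) (fun t => a t + b t) (da + db).
Proof. by move=> ha hb; exact: is_deriveD. Qed.

Lemma is_derive_sub (a b : R -> R) (s da db : R) :
  is_derive s (1 : R) a da -> is_derive s (1 : R) b db ->
  is_derive s (1 : R) (fun t => a t - b t) (da - db).
Proof. by move=> ha hb; exact: is_deriveB. Qed.

Lemma is_derive_opp (a : R -> R) (s da : R) :
  is_derive s (1 : R) a da -> is_derive s (1 : R) (fun t => - a t) (- da).
Proof. by move=> ha; exact: is_deriveN. Qed.

Lemma is_derive_scale (c : R) (a : R -> R) (s da : R) :
  is_derive s (1 : R) a da -> is_derive s (1 : R) (fun t => c * a t) (c * da).
Proof. by move=> ha; exact: is_deriveZ. Qed.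

Lemma is_derive_sqr (a : R -> R) (s da : R) :
  is_derive s (1 : R) a da -> is_derive s (1 : R) (fun t => a t ^+ 2) (2 * (a s * da)).
Proof.
move=> ha; have := is_derive_mul ha ha.
by rewrite (_ : a s * da + a s * da = 2 * (a s * da)); last by ring.
Qed.

Lemma is_derive_sqrt_comp (a : R -> R) (s da : R) : 0 < a s ->
  is_derive s (1 : R) a da ->
  is_derive s (1 : R) (fun t => Num.sqrt (a t)) (da / (2 * Num.sqrt (a s))).
Proof.
by move=> a0 ha; rewrite mulrC; exact: (is_derive1_comp (is_derive1_sqrt a0) ha).
Qed.

Lemma is_derive_hypot (P Q : R -> R) (s dP dQ : R) :
  0 < Num.sqrt (P s ^+ 2 + Q s ^+ 2) ->
  is_derive s (1 : R) P dP -> is_derive s (1 : R) Q dQ ->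
  is_derive s (1 : R) (fun t => Num.sqrt (P t ^+ 2 + Q t ^+ 2))
    ((P s * dP + Q s * dQ) / Num.sqrt (P s ^+ 2 + Q s ^+ 2)).
Proof.
move=> g0 hP hQ.
have g2 : 0 < P s ^+ 2 + Q s ^+ 2 by rewrite -sqrtr_gt0.
have h0 := is_derive_add (is_derive_sqr hP) (is_derive_sqr hQ).
have h : is_derive s (1 : R) (fun t => Num.sqrt (P t ^+ 2 + Q t ^+ 2)) _ :=
  @is_derive_sqrt_comp (fun t => P t ^+ 2 + Q t ^+ 2) s _ g2 h0.
apply: is_derive_eq h _.
by field; exact: lt0r_neq0.
Qed.

Lemma is_derive_exp_comp (a : R -> R) (s da : R) :
  is_derive s (1 : R) a da ->
  is_derive s (1 : R) (fun t => expR (a t)) (expR (a s) * da).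
Proof. by move=> ha; exact: (is_derive1_comp (is_derive_expR (a s)) ha). Qed.

Lemma is_derive_affine (a b t : R) : is_derive t (1 : R) (fun s : R => s * a + b) a.
Proof.
have h := is_derive_add (is_deriveM (is_derive_id t (1 : R)) (is_derive_cst a t (1 : R)))
  (is_derive_cst b t (1 : R)).
by apply: is_derive_eq h _; rewrite /GRing.scale /=; ring.
Qed.

End OneVariable.

(** * Eigenvalues of the scaled matrix and the equation they satisfy *)

Section Spectral.
Variable R : realType.
Implicit Types (D : set 'rV[R]_2) (f g u K : 'rV[R]_2 -> R) (x v w l : 'rV[R]_2).

Notation ex := (delta_mx 0 0 : 'rV[R]_2).
Notation ey := (delta_mx 0 1 : 'rV[R]_2).

Lemma continuous_coord2 i : continuous (fun x : 'rV[R]_2 => x 0 i).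
Proof. by move=> x; exact: (@coord_continuous R 1 2 0 i x). Qed.

Lemma enormE x : enorm x = Num.sqrt (x 0 0 ^+ 2 + x 0 1 ^+ 2).
Proof. by rewrite /enorm sum2. Qed.

Lemma continuous_sqnorm : continuous (fun x : 'rV[R]_2 => x 0 0 ^+ 2 + x 0 1 ^+ 2).
Proof.
have c (i : 'I_2) : continuous (fun h : 'rV[R]_2 => h 0 i ^+ 2).
  move=> h; apply: (@continuousM R 'rV[R]_2 (fun h => h 0 i) (fun h => h 0 i) h);
  exact: continuous_coord2.
move=> h; exact: (@continuousD R R^o 'rV[R]_2 _ _ h (c 0 h) (c 1 h)).
Qed.

Lemma eball_sq r x : 0 < r -> eball r x <-> x 0 0 ^+ 2 + x 0 1 ^+ 2 < r ^+ 2.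
Proof.
move=> r0; rewrite /eball /= enormE -{1}(gtr0_norm r0) -sqrtr_sqr.
by rewrite ltr_sqrt // exprn_gt0.
Qed.

Lemma eball_open r : 0 < r -> open (eball r : set 'rV[R]_2).
Proof.
move=> r0.
have -> : eball r = (fun x : 'rV[R]_2 => x 0 0 ^+ 2 + x 0 1 ^+ 2) @^-1` [set y | y < r ^+ 2].
  by apply/seteqP; split => x /= /eball_sq; apply.
by apply: open_comp; [move=> x _; exact: continuous_sqnorm|exact: open_lt].
Qed.

Lemma Gamma_open (p : R) : open (Gamma p).
Proof.
have -> : Gamma p = (lin2 (2 - p) 1 @^-1` [set y | 0 < y]) `&`
                    (lin2 1 (2 - p) @^-1` [set y | 0 < y]).
  by apply/seteqP; split => l; rewrite /Gamma /lin2 /= => -[? ?]; split; lra.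
by apply: openI; apply: open_comp; try exact: open_gt; move=> x _; exact: lin2_continuous.
Qed.

Lemma xcol01 l : xcol 0 1 l = l 0 1 *: ex + l 0 0 *: ey.
Proof.
apply/rowP => i; case: (ord2 i) => ->; rewrite !mxE ?perm.tpermL ?perm.tpermR /=; ring.
Qed.

Lemma vec2_0 (a b : R) : (a *: ex + b *: ey) 0 0 = a.
Proof. by rewrite !mxE /=; ring. Qed.

Lemma vec2_1 (a b : R) : (a *: ex + b *: ey) 0 1 = b.
Proof. by rewrite !mxE /=; ring. Qed.

(** The product of the two defining inequalities of the cone, written in terms
    of the determinant and the trace. *)
Lemma cone_inequality (p : R) l : Gamma p l -> p <= 2 ->
  0 < l 0 0 + l 0 1 /\
  0 < (p - 1) ^+ 2 * (l 0 0 * l 0 1) + (1 - (p - 1)) * (l 0 0 + l 0 1) ^+ 2.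
Proof.
move=> [h1 h2] p2; split.
  have : 0 < (3 - p) * (l 0 0 + l 0 1) by lra.
  by rewrite pmulr_rgt0 //; lra.
rewrite -subr_gt0 in h1; rewrite -subr_gt0 in h2.
by have := mulr_gt0 h1 h2; lra.
Qed.

Lemma det_mx2 (S : comNzRingType) (M : 'M[S]_2) :
  \det M = M 0 0 * M 1 1 - M 0 1 * M 1 0.
Proof.
rewrite (expand_det_row _ 0) big_ord_recl big_ord1 /cofactor !det_mx11 !mxE /=.
have -> : lift 0 0 = 1 :> 'I_2 by exact/val_inj.
have -> : lift 1 0 = 0 :> 'I_2 by exact/val_inj.
rewrite (_ : ord0 = 0) // /bump /= expr0 expr1; ring.
Qed.

Lemma eigenvalues_of_trace_det (M : 'M[R]_2) l : eigenvalues_of M l ->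
  l 0 0 + l 0 1 = M 0 0 + M 1 1 /\ l 0 0 * l 0 1 = M 0 0 * M 1 1 - M 0 1 * M 1 0.
Proof.
rewrite /eigenvalues_of => E.
have E2 (t : R) : (t - M 0 0) * (t - M 1 1) - M 0 1 * M 1 0 = (t - l 0 0) * (t - l 0 1).
  have := congr1 (fun q : {poly R} => q.[t]) E.
  rewrite /char_poly det_mx2 !mxE /= big_ord_recl big_ord1 !hornerE /=.
  rewrite (_ : lift ord0 0 = 1 :> 'I_2); last exact/val_inj.
  rewrite (_ : ord0 = 0 :> 'I_2) // => <-; ring.
by have E0 := E2 0; have E1 := E2 1; split; lra.
Qed.

End Spectral.

Section Equation.
Variable R : realType.
Implicit Types (D : set 'rV[R]_2) (f g u K : 'rV[R]_2 -> R) (x v w l : 'rV[R]_2).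

Notation ex := (delta_mx 0 0 : 'rV[R]_2).
Notation ey := (delta_mx 0 1 : 'rV[R]_2).

(** The trace, half the difference of the diagonal entries and the off-diagonal
    entry of [W = e^u A^u].  In these terms the eigenvalues of [W] are
    [traceW / 2 +- gapW], a smooth expression wherever [gapW > 0]. *)
Definition traceW u x : R := - (partial 0 (partial 0 u) x + partial 1 (partial 1 u) x).
Definition diffW u x : R :=
  2^-1 * (partial 1 (partial 1 u) x - partial 0 (partial 0 u) x) +
  4^-1 * (partial 0 u x ^+ 2 - partial 1 u x ^+ 2).
Definition offW u x : R :=
  2^-1 * (partial 0 u x * partial 1 u x) - partial 0 (partial 1 u) x.
Definition gapW u x : R := Num.sqrt (diffW u x ^+ 2 + offW u x ^+ 2).
Definition eigW u x : 'rV[R]_2 :=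
  (2^-1 * traceW u x + gapW u x) *: ex + (2^-1 * traceW u x - gapW u x) *: ey.

Lemma sqr_enorm x : enorm x ^+ 2 = x 0 0 ^+ 2 + x 0 1 ^+ 2.
Proof. by rewrite enormE sqr_sqrtr // addr_ge0 ?sqr_ge0. Qed.

Lemma AmatE u x i j : Amat u x i j =
  (expR (u x))^-1 * (- partial i (partial j u) x + 2^-1 * (partial i u x * partial j u x)
   - 4^-1 * (partial 0 u x ^+ 2 + partial 1 u x ^+ 2) * (i == j)%:R).
Proof.
rewrite /Amat sqr_enorm !mxE big_ord1 !mxE /=.
move: (partial i (partial j u) x) (partial i u x) (partial j u x).
move: (partial 0 u x) (partial 1 u x) (expR (u x)) (i == j)%:R => a b e d c a' b'.
ring.
Qed.

Lemma root_pair (t P Q a b : R) : a + b = t -> a * b = 4^-1 * t ^+ 2 - (P ^+ 2 + Q ^+ 2) ->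
  let s := Num.sqrt (P ^+ 2 + Q ^+ 2) in
  (2^-1 * t + s = a /\ 2^-1 * t - s = b) \/ (2^-1 * t + s = b /\ 2^-1 * t - s = a).
Proof.
move=> tr dt s.
have : (a - 2^-1 * t) ^+ 2 = s ^+ 2.
  rewrite /s sqr_sqrtr ?addr_ge0 ?sqr_ge0 //.
  have -> : P ^+ 2 + Q ^+ 2 = 4^-1 * t ^+ 2 - a * b by rewrite dt; ring.
  by rewrite -tr; field.
by move/eqP; rewrite eqf_sqr => /orP[] /eqP E; [left|right]; split; lra.
Qed.

Lemma Gamma_scale p (t : R) l : 0 < t -> Gamma p l -> Gamma p (t *: l).
Proof. by move=> t0 [h1 h2]; split; rewrite !mxE mulrCA ltr_pM2l. Qed.

(** The eigenvalues of [A^u] come in an unspecified order, hence the two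
    cases. *)
Lemma eigen_scaled u x l : partial 0 (partial 1 u) x = partial 1 (partial 0 u) x ->
  eigenvalues_of (Amat u x) l ->
  eigW u x = expR (u x) *: l \/ eigW u x = expR (u x) *: xcol 0 1 l.
Proof.
move=> sym /eigenvalues_of_trace_det; rewrite !AmatE sym /= => -[tr dt].
have e0 : expR (u x) != 0 by rewrite gt_eqF ?expR_gt0.
have key : (expR (u x) * l 0 0) + (expR (u x) * l 0 1) = traceW u x /\
  (expR (u x) * l 0 0) * (expR (u x) * l 0 1) =
  4^-1 * traceW u x ^+ 2 - (diffW u x ^+ 2 + offW u x ^+ 2).
  rewrite /traceW /diffW /offW sym; move: tr dt e0.
  move: (partial 0 (partial 0 u) x) (partial 1 (partial 0 u) x)
    (partial 1 (partial 1 u) x) (partial 0 u x) (partial 1 u x) (expR (u x)) (l 0 0) (l 0 1).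
  move=> u00 u01 u11 u0 u1 e l0 l1 tr dt e0; split.
    by rewrite -mulrDr tr; field.
  have -> : e * l0 * (e * l1) = e ^+ 2 * (l0 * l1) by ring.
  by rewrite dt; field.
case: key => /root_pair h /h [] [E0 E1]; [left|right].
  by rewrite /eigW /gapW E0 E1 {3}(rV2E l) scalerDr !scalerA.
by rewrite /eigW /gapW E0 E1 xcol01 scalerDr !scalerA.
Qed.

Lemma Gamma_swap p l : Gamma p l -> Gamma p (xcol 0 1 l).
Proof. by case=> h1 h2; rewrite xcol01; split; rewrite vec2_0 vec2_1. Qed.

(** Symmetry of [f] makes the order of the eigenvalues irrelevant and
    homogeneity absorbs the factor [e^u], so the equation becomes one about the
    explicit functions [eigW]. *)
Lemma spectral_equation p f u x l :
  (forall l, closure (Gamma p) l -> f (xcol 0 1 l) = f l) ->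
  (forall (t : R) l, 0 < t -> closure (Gamma p) l -> f (t *: l) = t * f l) ->
  partial 0 (partial 1 u) x = partial 1 (partial 0 u) x ->
  eigenvalues_of (Amat u x) l -> Gamma p l ->
  Gamma p (eigW u x) /\ f (eigW u x) = expR (u x) * f l.
Proof.
move=> f_sym f_hom sym /(eigen_scaled sym) Elam Gl.
have e0 := expR_gt0 (u x).
have Gs := Gamma_swap Gl.
case: Elam => ->.
  split; first exact: (Gamma_scale e0 Gl).
  exact: (f_hom _ _ e0 (subset_closure Gl)).
split; first exact: (Gamma_scale e0 Gs).
apply: etrans (f_hom _ _ e0 (subset_closure Gs)) _.
exact: congr1 (f_sym _ (subset_closure Gl)).
Qed.

(** Differentiate [f (t l) = t f l] at [t = 1]. *)
Lemma euler_relation p f l : classC 1 (Gamma p) f ->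
  (forall (t : R) l, 0 < t -> closure (Gamma p) l -> f (t *: l) = t * f l) ->
  Gamma p l -> l 0 0 * partial 0 f l + l 0 1 * partial 1 f l = f l.
Proof.
move=> fC f_hom Gl.
have Gl1 : Gamma p (1 *: l + 0) by rewrite scale1r addr0.
have := is_derive_along (@Gamma_open R p) fC Gl1.
rewrite scale1r addr0 => -[_ <-].
have d2 : is_derive (1 : R) (1 : R) (fun t => t * f l) (f l).
  have h := is_deriveM (is_derive_id (1 : R) (1 : R)) (is_derive_cst (f l) (1 : R) (1 : R)).
  by apply: is_derive_eq h _; rewrite /GRing.scale /=; ring.
have [_ E2] := d2; rewrite -[RHS]E2.
apply: near_eq_derive.
have npos : nbhs (1 : R) [set t | 0 < t].
  by apply: open_nbhs_nbhs; split; [exact: open_gt|exact: ltr01].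
apply: filterS npos => t t0; rewrite addr0.
exact: (f_hom _ _ t0 (subset_closure Gl)).
Qed.

(** The left-hand side is [F : partial_k W] for the derivative [F] of
    [W |-> f (eig W)], with [dt], [dp], [dq] the derivatives of [traceW],
    [diffW], [offW]; the last quotient is the derivative of [gapW]. *)
Lemma derivative_of_equation D p f K u x k :
  open D -> classC 3 D u -> classC 1 D K -> classC 1 (Gamma p) f ->
  (forall y, D y -> Gamma p (eigW u y) /\ f (eigW u y) = expR (u y) * K y) ->
  D x -> 0 < gapW u x ->
  let f0 := partial 0 f (eigW u x) in let f1 := partial 1 f (eigW u x) in
  let u0 := partial 0 u x in let u1 := partial 1 u x in
  let dt := - (partial k (partial 0 (partial 0 u)) x + partial k (partial 1 (partial 1 u)) x) in
  let dp := 2^-1 * (partial k (partial 1 (partial 1 u)) x - partial k (partial 0 (partial 0 u)) x)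
     + 4^-1 * (2 * (u0 * partial k (partial 0 u) x) - 2 * (u1 * partial k (partial 1 u) x)) in
  let dq := 2^-1 * (u0 * partial k (partial 1 u) x + u1 * partial k (partial 0 u) x)
     - partial k (partial 0 (partial 1 u)) x in
  2^-1 * (f0 + f1) * dt + (f0 - f1) * ((diffW u x * dp + offW u x * dq) / gapW u x) =
  expR (u x) * (partial k K x + K x * partial k u x).
Proof.
move=> oD [_ uC] [_ KC] fC eqn Dx gap0 f0 f1 u0 u1 dt dp dq.
pose ek : 'rV[R]_2 := delta_mx 0 k.
have x0 : 0 *: ek + x = x by rewrite scale0r add0r.
have L g : derivable g x ek ->
    is_derive (0 : R) (1 : R) (fun h : R => g (h *: ek + x)) (partial k g x).
  exact: is_derive_line0.
have L1 i : is_derive (0 : R) (1 : R) (fun h : R => partial i u (h *: ek + x))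
    (partial k (partial i u) x).
  by apply: L; have [_ [_ /(_ k) [+ _]]] := uC i; apply.
have L2 i j : is_derive (0 : R) (1 : R) (fun h : R => partial i (partial j u) (h *: ek + x))
    (partial k (partial i (partial j u)) x).
  by apply: L; have [_ [_ /(_ i) [_ [_ /(_ k) [+ _]]]]] := uC j; apply.
have Lu : is_derive (0 : R) (1 : R) (fun h : R => u (h *: ek + x)) (partial k u x).
  by apply: L; have [+ _] := uC k; apply.
have LK : is_derive (0 : R) (1 : R) (fun h : R => K (h *: ek + x)) (partial k K x).
  by apply: L; have [+ _] := KC k; apply.
have Lt : is_derive (0 : R) (1 : R) (fun h : R => traceW u (h *: ek + x)) dt.
  exact: is_derive_opp (is_derive_add (L2 0 0) (L2 1 1)).
have Lp : is_derive (0 : R) (1 : R) (fun h : R => diffW u (h *: ek + x)) dp.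
  have := is_derive_add (is_derive_scale 2^-1 (is_derive_sub (L2 1 1) (L2 0 0)))
    (is_derive_scale 4^-1 (is_derive_sub (is_derive_sqr (L1 0)) (is_derive_sqr (L1 1)))).
  by rewrite x0.
have Lq : is_derive (0 : R) (1 : R) (fun h : R => offW u (h *: ek + x)) dq.
  have := is_derive_sub (is_derive_scale 2^-1 (is_derive_mul (L1 0) (L1 1))) (L2 0 1).
  by rewrite x0.
pose dg := (diffW u x * dp + offW u x * dq) / gapW u x.
have Lg : is_derive (0 : R) (1 : R) (fun h : R => gapW u (h *: ek + x)) dg.
  by have := is_derive_hypot _ Lp Lq; rewrite x0 => /(_ gap0).
have D0 : Gamma p ((2^-1 * traceW u (0 *: ek + x) + gapW u (0 *: ek + x)) *: ex +
                   (2^-1 * traceW u (0 *: ek + x) - gapW u (0 *: ek + x)) *: ey).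
  by rewrite x0; case: (eqn x Dx).
have Hl : is_derive (0 : R) (1 : R) (fun h : R => f (eigW u (h *: ek + x)))
    ((2^-1 * dt + dg) * f0 + (2^-1 * dt - dg) * f1).
  have := @is_derive_curve R (Gamma p) f
    (fun h => 2^-1 * traceW u (h *: ek + x) + gapW u (h *: ek + x))
    (fun h => 2^-1 * traceW u (h *: ek + x) - gapW u (h *: ek + x)) 0 _ _ (@Gamma_open R p) fC D0
    (is_derive_add (is_derive_scale 2^-1 Lt) Lg) (is_derive_sub (is_derive_scale 2^-1 Lt) Lg).
  by rewrite x0.
have Hr : is_derive (0 : R) (1 : R) (fun h : R => expR (u (h *: ek + x)) * K (h *: ek + x))
    (expR (u x) * partial k K x + K x * (expR (u x) * partial k u x)).
  by have := is_derive_mul (is_derive_exp_comp Lu) LK; rewrite x0.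
have E : \forall t \near (0 : R), f (eigW u (t *: ek + x)) =
    expR (u (t *: ek + x)) * K (t *: ek + x).
  by apply: filterS (near_line ek oD Dx) => t /eqn[].
have := near_eq_derive (1 : R) E.
have [_ ->] := Hl; have [_ ->] := Hr.
have alg (c a b t' Kk K' uk e : R) :
    (2^-1 * t' + c) * a + (2^-1 * t' - c) * b = e * Kk + K' * (e * uk) ->
    2^-1 * (a + b) * t' + (a - b) * c = e * (Kk + K' * uk).
  move=> E0; rewrite (_ : e * (Kk + K' * uk) = e * Kk + K' * (e * uk)); last by ring.
  by rewrite -E0; ring.
exact: alg.
Qed.

End Equation.

(** * Conditions at a maximum of the weighted gradient *)

Section MaxPoint.
Variable R : realType.
Implicit Types (D : set 'rV[R]_2) (f g u K : 'rV[R]_2 -> R) (x v w l : 'rV[R]_2).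

Notation ex := (delta_mx 0 0 : 'rV[R]_2).
Notation ey := (delta_mx 0 1 : 'rV[R]_2).

(** First- and second-order conditions for [e^2 (a0^2 + a1^2)], with the first
    one already inserted in the second to eliminate the mixed term
    [e e1 n1]. *)
Lemma weighted_max (d : R) (e e1 a0 b0 a1 b1 : R -> R) (e2 c0 c1 : R) : 0 < d ->
  (forall t, `|t| < d -> is_derive t (1 : R) e (e1 t)) ->
  (forall t, `|t| < d -> is_derive t (1 : R) a0 (b0 t)) ->
  (forall t, `|t| < d -> is_derive t (1 : R) a1 (b1 t)) ->
  is_derive (0 : R) (1 : R) e1 e2 ->
  is_derive (0 : R) (1 : R) b0 c0 ->
  is_derive (0 : R) (1 : R) b1 c1 ->
  (forall t, `|t| < d ->
     e t ^+ 2 * (a0 t ^+ 2 + a1 t ^+ 2) <= e 0 ^+ 2 * (a0 0 ^+ 2 + a1 0 ^+ 2)) ->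
  0 < e 0 ->
  let n := a0 0 ^+ 2 + a1 0 ^+ 2 in
  let n1 := a0 0 * b0 0 + a1 0 * b1 0 in
  e 0 * n1 = - e1 0 * n /\
  e 0 ^+ 2 * (b0 0 ^+ 2 + b1 0 ^+ 2 + a0 0 * c0 + a1 0 * c1) - 3 * e1 0 ^+ 2 * n
    + e 0 * e2 * n <= 0.
Proof.
move=> d0 he ha0 ha1 he1 hb0 hb1 max e_gt0 n n1.
pose df t := (e t ^+ 2 * (2 * (a0 t * b0 t) + 2 * (a1 t * b1 t))) +
   (a0 t ^+ 2 + a1 t ^+ 2) * (2 * (e t * e1 t)).
have hf t : `|t| < d ->
    is_derive t (1 : R) (fun t => e t ^+ 2 * (a0 t ^+ 2 + a1 t ^+ 2)) (df t).
  move=> td.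
  have hn := is_derive_add (is_derive_sqr (ha0 t td)) (is_derive_sqr (ha1 t td)).
  exact: (@is_derive_mul R (fun t => e t ^+ 2) (fun t => a0 t ^+ 2 + a1 t ^+ 2) t _ _
    (is_derive_sqr (he t td)) hn).
have z0 : `|0 : R| < d by rewrite normr0.
have he0 := he 0 z0; have ha00 := ha0 0 z0; have ha10 := ha1 0 z0.
have h1 := @is_derive_add R (fun t => 2 * (a0 t * b0 t)) (fun t => 2 * (a1 t * b1 t)) 0 _ _
  (is_derive_scale 2 (is_derive_mul ha00 hb0)) (is_derive_scale 2 (is_derive_mul ha10 hb1)).
have h2 := @is_derive_mul R (fun t => e t ^+ 2)
  (fun t => 2 * (a0 t * b0 t) + 2 * (a1 t * b1 t)) 0 _ _ (is_derive_sqr he0) h1.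
have h3 := is_derive_add (is_derive_sqr ha00) (is_derive_sqr ha10).
have h4 := @is_derive_mul R (fun t => a0 t ^+ 2 + a1 t ^+ 2) (fun t => 2 * (e t * e1 t)) 0 _ _
  h3 (is_derive_scale 2 (is_derive_mul he0 he1)).
have h5 : is_derive (0 : R) (1 : R) df _ := is_derive_add h2 h4.
have [df0 ddf] := derive2_at_max d0 hf max h5.
have first : e 0 * n1 = - e1 0 * n.
  apply: (mulfI (lt0r_neq0 e_gt0)); move: df0; rewrite /df /n /n1; lra.
split => //.
have sec : e 0 * e1 0 * n1 = - (e1 0 ^+ 2 * n).
  by rewrite mulrAC [X in X * _]mulrC -mulrA; move: first => /(congr1 ( *%R (e1 0))); rewrite /n /n1; lra.
by move: ddf sec; rewrite /n /n1; lra.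
Qed.

Lemma line_coord x v (t : R) i : (t *: v + x) 0 i = t * v 0 i + x 0 i.
Proof. by rewrite !mxE. Qed.

(** [weighted_max] on the line through [x] in direction [v]: the weight has
    derivatives [-2 v.x] and [-2 |v|^2], and [d k], [dd k] are the first two
    derivatives of [partial k u] along that line. *)
Lemma max_point_conditions D (rho : R) u x : open D -> classC 3 D u -> D x ->
  let eta (y : 'rV[R]_2) := rho ^+ 2 - (y 0 0 ^+ 2 + y 0 1 ^+ 2) in
  let N (y : 'rV[R]_2) := partial 0 u y ^+ 2 + partial 1 u y ^+ 2 in
  0 < eta x ->
  (forall y, D y -> eta y ^+ 2 * N y <= eta x ^+ 2 * N x) ->
  forall v,
  let d k := v 0 0 * partial 0 (partial k u) x + v 0 1 * partial 1 (partial k u) x in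
  let dd k :=
    v 0 0 * (v 0 0 * partial 0 (partial 0 (partial k u)) x
             + v 0 1 * partial 1 (partial 0 (partial k u)) x) +
    v 0 1 * (v 0 0 * partial 0 (partial 1 (partial k u)) x
             + v 0 1 * partial 1 (partial 1 (partial k u)) x) in
  let vx := v 0 0 * x 0 0 + v 0 1 * x 0 1 in
  eta x * (partial 0 u x * d 0 + partial 1 u x * d 1) = 2 * vx * N x /\
  eta x ^+ 2 * (d 0 ^+ 2 + d 1 ^+ 2 + partial 0 u x * dd 0 + partial 1 u x * dd 1)
    - 12 * vx ^+ 2 * N x - 2 * eta x * (v 0 0 ^+ 2 + v 0 1 ^+ 2) * N x <= 0.
Proof.
move=> oD [_ uC] Dx eta N eta0 max v d dd vx.
have x0 : 0 *: v + x = x by rewrite scale0r add0r.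
have C2 k : classC 2 D (partial k u) by have [] := uC k.
have C1 k : classC 1 D (partial k u) by exact: classCS (C2 k).
have C1' i k : classC 1 D (partial i (partial k u)).
  by have [_ /(_ i)[]] := C2 k.
pose a k (t : R) := partial k u (t *: v + x).
pose b k (t : R) := v 0 0 * partial 0 (partial k u) (t *: v + x) +
                    v 0 1 * partial 1 (partial k u) (t *: v + x).
pose e (t : R) := rho ^+ 2 - ((t * v 0 0 + x 0 0) ^+ 2 + (t * v 0 1 + x 0 1) ^+ 2).
pose e1 (t : R) := 0 - (2 * ((t * v 0 0 + x 0 0) * v 0 0) + 2 * ((t * v 0 1 + x 0 1) * v 0 1)).
have nD := near_line v oD Dx.
have [r0 r0_gt0 rP] : exists2 r0 : R, 0 < r0 & forall t, `|t| < r0 -> D (t *: v + x).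
  have /nbhs_ballP[r0 /= r0_gt0 rP] := nD.
  by exists r0 => // t tr; apply: rP; rewrite -ball_normE /ball_ /= sub0r normrN.
have etaE t : eta (t *: v + x) = e t by rewrite /eta !line_coord.
have ha k t : `|t| < r0 -> is_derive t (1 : R) (a k) (b k t).
  by move=> /rP Dt; exact: (is_derive_along oD (C1 k) Dt).
have hb k : is_derive (0 : R) (1 : R) (b k) (dd k).
  have D0 : D (0 *: v + x) by rewrite x0.
  have := @is_derive_add R (fun t => v 0 0 * partial 0 (partial k u) (t *: v + x))
   (fun t => v 0 1 * partial 1 (partial k u) (t *: v + x)) 0 _ _
   (is_derive_scale (v 0 0) (is_derive_along oD (C1' 0 k) D0))
   (is_derive_scale (v 0 1) (is_derive_along oD (C1' 1 k) D0)).
  by rewrite x0.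
have he t : is_derive t (1 : R) e (e1 t).
  exact: (is_derive_sub (is_derive_cst (rho ^+ 2) t (1 : R))
    (@is_derive_add R (fun t => (t * v 0 0 + x 0 0) ^+ 2) (fun t => (t * v 0 1 + x 0 1) ^+ 2) t _ _
    (is_derive_sqr (is_derive_affine _ _ t)) (is_derive_sqr (is_derive_affine _ _ t)))).
have he1 : is_derive (0 : R) (1 : R) e1 (- 2 * (v 0 0 ^+ 2 + v 0 1 ^+ 2)).
  have hl (i : 'I_2) := @is_derive_mul R (fun t => t * v 0 i + x 0 i) (cst (v 0 i)) 0 _ _
    (is_derive_affine (v 0 i) (x 0 i) 0) (is_derive_cst (v 0 i) (0 : R) (1 : R)).
  have h := is_derive_sub (is_derive_cst (0 : R) (0 : R) (1 : R))
    (is_derive_add (is_derive_scale 2 (hl 0)) (is_derive_scale 2 (hl 1))).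
  by apply: is_derive_eq h _; rewrite /=; ring.
have mx t : `|t| < r0 -> e t ^+ 2 * (a 0 t ^+ 2 + a 1 t ^+ 2) <=
    e 0 ^+ 2 * (a 0 0 ^+ 2 + a 1 0 ^+ 2).
  by move=> /rP/max; rewrite -!etaE /a x0.
have ex0 : e 0 = eta x by rewrite -etaE x0.
have e0 : 0 < e 0 by rewrite ex0.
have [] := weighted_max r0_gt0 (fun t _ => he t) (ha 0) (ha 1) he1 (hb 0) (hb 1) mx e0.
have e10 : e1 0 = - (2 * vx) by rewrite /e1 /vx; ring.
have bd k : b k 0 = d k by rewrite /b x0.
have ax k : a k 0 = partial k u x by rewrite /a x0.
have alg1 (X w n : R) : X = - - (2 * w) * n -> X = 2 * w * n by rewrite opprK.
have alg2 (X w n et V : R) : X - 3 * (- (2 * w)) ^+ 2 * n + et * (- 2 * V) * n <= 0 ->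
    X - 12 * w ^+ 2 * n - 2 * et * V * n <= 0 by lra.
rewrite ex0 e10 !bd !ax -/(N x) => E1 E2.
by split; [exact: alg1 E1|exact: alg2 E2].
Qed.

End MaxPoint.

(** * Positive quadratic forms and the cone *)

Section TraceForm.
Variable R : realType.
Implicit Types k : R.

Lemma psd_form_ge0 (F00 F01 F11 a b : R) : 0 < F00 -> 0 <= F00 * F11 - F01 ^+ 2 ->
  0 <= F00 * a ^+ 2 + 2 * F01 * a * b + F11 * b ^+ 2.
Proof.
move=> F0 dF; rewrite -(pmulr_rge0 _ F0).
have -> : F00 * (F00 * a ^+ 2 + 2 * F01 * a * b + F11 * b ^+ 2) =
  (F00 * a + F01 * b) ^+ 2 + (F00 * F11 - F01 ^+ 2) * b ^+ 2 by ring.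
exact: addr_ge0 (sqr_ge0 _) (mulr_ge0 dF (sqr_ge0 _)).
Qed.

(** A positive definite [F] is a sum of two squares of linear forms, obtained
    by completing the square; so its trace pairing with a form that is
    nonpositive on vectors is nonpositive. *)
Lemma psd_trace_le0 (F00 F01 F11 q00 q01 q11 : R) :
  0 < F00 -> 0 <= F00 * F11 - F01 ^+ 2 ->
  (forall a b : R, q00 * a ^+ 2 + 2 * q01 * a * b + q11 * b ^+ 2 <= 0) ->
  F00 * q00 + 2 * F01 * q01 + F11 * q11 <= 0.
Proof.
move=> F0 dF q; have qv := q F00 F01.
have q1 : q11 <= 0 by have := q 0 1; lra.
rewrite -(pmulr_rle0 _ F0).
have -> : F00 * (F00 * q00 + 2 * F01 * q01 + F11 * q11) =
  (q00 * F00 ^+ 2 + 2 * q01 * F00 * F01 + q11 * F01 ^+ 2) +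
  (F00 * F11 - F01 ^+ 2) * q11 by ring.
by have := mulr_ge0_le0 dF q1; lra.
Qed.

(** Here [al], [be], [de] are the entries of [D^2 u / |du|^2] in the frame of
    [du], so that [W / |du|^2] has the entries [1/4 - al], [- be],
    [- de - 1/4].  At [al = be = 0] the cone condition
    [k^2 det + (1 - k) tr^2 > 0] reads [k^2 (- de - 1/4) / 4 + (1 - k) de^2 > 0],
    which for negative [de] amounts to [de < - k / 4]; the constants [k / 8] and
    [k / 1000] leave room for the perturbation. *)
Lemma cone_transversal_bound (k al be de : R) : 0 < k <= 1 ->
  `|al| <= k / 1000 -> `|be| <= k / 1000 -> 0 < - al - de ->
  0 < k ^+ 2 * ((4^-1 - al) * (- de - 4^-1) - be ^+ 2) + (1 - k) * (al + de) ^+ 2 ->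
  de < - (k / 8).
Proof.
move=> /andP[k0 k1] /ler_normlP[al1 al2] /ler_normlP[be1 be2] tr0 cone.
rewrite ltNge; apply/negP => de8.
have h1 : (4^-1 - al) * (- de - 4^-1) <= - (31 / 1000) by nra.
have h2 : (al + de) ^+ 2 <= (126 / 1000 * k) ^+ 2 by nra.
have h3 : 0 <= k ^+ 2 by apply: sqr_ge0.
have h4 : k ^+ 2 * ((4^-1 - al) * (- de - 4^-1) - be ^+ 2) <= k ^+ 2 * - (31 / 1000).
  by apply: ler_wpM2l => //; rewrite lerBlDr; apply: le_trans h1 _; rewrite lerDl sqr_ge0.
have h5 : (1 - k) * (al + de) ^+ 2 <= (126 / 1000 * k) ^+ 2.
  apply: le_trans h2; rewrite ler_piMl ?sqr_ge0 //; lra.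
have : 0 < k ^+ 2 * - (31 / 1000) + (126 / 1000 * k) ^+ 2.
  by apply: lt_le_trans cone _; apply: lerD.
nra.
Qed.

(** Besides [de < - k / 8] what matters is that [C], the entry of [F] in the
    direction orthogonal to [du], is at least a fixed part of the trace.  This
    follows from Euler's relation: its left-hand side is about
    [A / 4 + C (- de - 1/4)] and its right-hand side is small. *)
Lemma trace_form_lower_bound (k al be de A B C h : R) : 0 < k <= 1 ->
  0 < A -> 0 <= A * C - B ^+ 2 ->
  `|al| <= k / 1000 -> `|be| <= k / 1000 -> 0 < - al - de ->
  0 < k ^+ 2 * ((4^-1 - al) * (- de - 4^-1) - be ^+ 2) + (1 - k) * (al + de) ^+ 2 ->
  A * (4^-1 - al) + 2 * B * (- be) + C * (- de - 4^-1) = h ->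
  h <= (A + C) * (k / 1000) ->
  (A + C) * (k ^+ 2 / 512) <=
    A * (al ^+ 2 + be ^+ 2) + 2 * B * (be * (al + de)) + C * (be ^+ 2 + de ^+ 2).
Proof.
move=> k01 A0 dF al_s be_s tr0 cone euler hs.
have de8 := cone_transversal_bound k01 al_s be_s tr0 cone.
have := psd_form_ge0 al be A0 dF.
move: k01 al_s be_s => /andP[k0 k1] /ler_normlP[al1 al2] /ler_normlP[be1 be2].
have C0 : 0 <= C by rewrite -(pmulr_rge0 _ A0); have := sqr_ge0 B; lra.
have T0 : 0 < A + C by lra.
have [B1 B2] : - (A + C) <= 2 * B /\ 2 * B <= A + C.
  have : (2 * B) ^+ 2 <= (A + C) ^+ 2 by have := sqr_ge0 (A - C); nra.
  rewrite -[_ <= _ ^+ 2]ler_sqrt ?sqr_ge0 // !sqrtr_sqr (ger0_norm (ltW T0)) => hB.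
  by move: hB => /ler_normlP[? ?]; lra.
have Bb : - ((A + C) * (k / 1000)) <= 2 * B * (- be).
  have : `|2 * B * (- be)| <= (A + C) * (k / 1000).
    rewrite normrM ler_pM // ler_norml; lra.
  by move=> /ler_normlP[]; lra.
have CT : (A + C) / 4 <= C by nra.
(* de < 0, hence the direction of the bound *)
have Bbd : (A + C) * (k / 1000) * de <= 2 * B * (be * de).
  have : `|2 * B * be| <= (A + C) * (k / 1000).
    by rewrite normrM ler_pM // ler_norml; lra.
  by move=> /ler_normlP[? ?]; nra.
have main : (A + C) * (k ^+ 2 / 512) <= (A + C) * (k / 1000) * de + C * de ^+ 2.
  have q : (A + C) * ((k / 1000) * de + 4^-1 * de ^+ 2) <= (A + C) * (k / 1000) * de + C * de ^+ 2.
    by have := sqr_ge0 de; nra.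
  apply: le_trans q; apply: ler_wpM2l; first exact: ltW.
  nra.
have b2 : 0 <= A * be ^+ 2 by rewrite mulr_ge0 ?sqr_ge0 // ltW.
lra.
Qed.

End TraceForm.

Section Contraction.
Variable R : realType.

(** The third derivatives occur in the second-order condition as
    [F^ij u_k u_ijk], and the equation differentiated along [du] expresses just
    this sum by lower-order terms.  In those terms the first-order conditions
    replace [D^2u du] by a multiple of [x]. *)
Lemma contracted_inequality
  (F00 F01 F11 eta N x0 x1 u0 u1 u00 u01 u11 u000 u001 u011 u111 h0 h1 : R) :
  0 < F00 -> 0 <= F00 * F11 - F01 ^+ 2 ->
  eta * (u0 * u00 + u1 * u01) = 2 * x0 * N ->
  eta * (u0 * u01 + u1 * u11) = 2 * x1 * N ->
  F00 * (- u000 + 2^-1 * (u0 * u00 - u1 * u01)) + 2 * F01 * (- u001 + 2^-1 * (u00 * u1 + u0 * u01))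
    + F11 * (- u011 - 2^-1 * (u0 * u00 - u1 * u01)) = h0 ->
  F00 * (- u001 + 2^-1 * (u0 * u01 - u1 * u11)) + 2 * F01 * (- u011 + 2^-1 * (u01 * u1 + u0 * u11))
    + F11 * (- u111 - 2^-1 * (u0 * u01 - u1 * u11)) = h1 ->
  (forall a b : R,
    eta ^+ 2 * ((a * u00 + b * u01) ^+ 2 + (a * u01 + b * u11) ^+ 2
      + u0 * (a * (a * u000 + b * u001) + b * (a * u001 + b * u011))
      + u1 * (a * (a * u001 + b * u011) + b * (a * u011 + b * u111)))
    - 12 * (a * x0 + b * x1) ^+ 2 * N - 2 * eta * (a ^+ 2 + b ^+ 2) * N <= 0) ->
  eta ^+ 2 * (F00 * (u00 ^+ 2 + u01 ^+ 2) + 2 * F01 * (u01 * (u00 + u11)) + F11 * (u01 ^+ 2 + u11 ^+ 2))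
  <= 12 * N * (F00 * x0 ^+ 2 + 2 * F01 * x0 * x1 + F11 * x1 ^+ 2)
     + 2 * eta * N * (F00 + F11)
     - 2 * N * eta * (F00 * x0 * u0 + F01 * (x0 * u1 + x1 * u0) + F11 * x1 * u1)
     + N * eta * (F00 + F11) * (x0 * u0 + x1 * u1)
     + eta ^+ 2 * (h0 * u0 + h1 * u1).
Proof.
move=> F0 dF p0 p1 <- <- q.
pose q00 := eta ^+ 2 * (u00 ^+ 2 + u01 ^+ 2 + u0 * u000 + u1 * u001)
   - 12 * x0 ^+ 2 * N - 2 * eta * N.
pose q01 := eta ^+ 2 * (u01 * (u00 + u11) + u0 * u001 + u1 * u011) - 12 * x0 * x1 * N.
pose q11 := eta ^+ 2 * (u01 ^+ 2 + u11 ^+ 2 + u0 * u011 + u1 * u111)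
   - 12 * x1 ^+ 2 * N - 2 * eta * N.
have /(psd_trace_le0 F0 dF) : forall a b : R, q00 * a ^+ 2 + 2 * q01 * a * b + q11 * b ^+ 2 <= 0.
  by move=> a b; have := q a b; congr (_ <= 0); rewrite /q00 /q01 /q11; ring.
move=> H; rewrite -subr_le0; move: H; congr (_ <= 0).
rewrite /q00 /q01 /q11 => {q}.
have -> : 2 * N * eta * (F00 * x0 * u0 + F01 * (x0 * u1 + x1 * u0) + F11 * x1 * u1) =
  eta * (F00 * (2 * x0 * N) * u0 + F01 * ((2 * x0 * N) * u1 + (2 * x1 * N) * u0) + F11 * (2 * x1 * N) * u1) by ring.
have -> : N * eta * (F00 + F11) * (x0 * u0 + x1 * u1) =
  2^-1 * eta * (F00 + F11) * ((2 * x0 * N) * u0 + (2 * x1 * N) * u1) by field.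
by rewrite -p0 -p1; field.
Qed.

(** [F (x, x) F (u, u) - F (x, u)^2 = det F (x0 u1 - x1 u0)^2]. *)
Lemma cauchy_schwarz_form (F00 F01 F11 x0 x1 u0 u1 r g : R) :
  0 < F00 -> 0 <= F00 * F11 - F01 ^+ 2 -> 0 <= r -> 0 <= g ->
  x0 ^+ 2 + x1 ^+ 2 <= r ^+ 2 -> u0 ^+ 2 + u1 ^+ 2 <= g ^+ 2 ->
  `|F00 * x0 * u0 + F01 * (x0 * u1 + x1 * u0) + F11 * x1 * u1| <= (F00 + F11) * r * g.
Proof.
move=> F0 dF r0 g0 xr ug.
have F1 : 0 <= F11 by rewrite -(pmulr_rge0 _ F0); have := sqr_ge0 F01; lra.
have T0 : 0 <= F00 + F11 by lra.
have form (a b c : R) : a ^+ 2 + b ^+ 2 <= c ^+ 2 ->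
    F00 * a ^+ 2 + 2 * F01 * a * b + F11 * b ^+ 2 <= (F00 + F11) * c ^+ 2.
  move=> abc; have := psd_form_ge0 b (- a) F0 dF; have := ler_wpM2l T0 abc; lra.
rewrite -[leRHS]ger0_norm ?mulr_ge0 // -[leLHS]sqrtr_sqr -[leRHS]sqrtr_sqr.
apply: ler_wsqrtr.
have fx := form _ _ _ xr; have fu := form _ _ _ ug.
apply: (@le_trans _ _ ((F00 * x0 ^+ 2 + 2 * F01 * x0 * x1 + F11 * x1 ^+ 2) *
   (F00 * u0 ^+ 2 + 2 * F01 * u0 * u1 + F11 * u1 ^+ 2))).
  have := mulr_ge0 dF (sqr_ge0 (x0 * u1 - x1 * u0)); lra.
rewrite (_ : ((F00 + F11) * r * g) ^+ 2 = ((F00 + F11) * r ^+ 2) * ((F00 + F11) * g ^+ 2)); last by ring.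
by apply: ler_pM => //; exact: psd_form_ge0.
Qed.

Lemma dot_bound (x0 x1 u0 u1 r g : R) : 0 <= r -> 0 <= g ->
  x0 ^+ 2 + x1 ^+ 2 <= r ^+ 2 -> u0 ^+ 2 + u1 ^+ 2 <= g ^+ 2 ->
  `|x0 * u0 + x1 * u1| <= r * g.
Proof.
move=> r0 g0 xr ug.
rewrite -[leRHS]ger0_norm ?mulr_ge0 // -[leLHS]sqrtr_sqr -[leRHS]sqrtr_sqr.
apply: ler_wsqrtr.
apply: (@le_trans _ _ ((x0 ^+ 2 + x1 ^+ 2) * (u0 ^+ 2 + u1 ^+ 2))).
  have := sqr_ge0 (x0 * u1 - x1 * u0); lra.
by rewrite exprMn; apply: ler_pM => //; rewrite addr_ge0 ?sqr_ge0.
Qed.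

End Contraction.

Section LowerBound.
Variable R : realType.

(** [trace_form_lower_bound] in the orthonormal frame [u / |u|], [u' / |u|]
    where [u' = (- u1, u0)], divided by suitable powers of [N = |u|^2].  All
    entries in that frame are rational in [u0], [u1], so no square root is
    needed; trace, determinant and the pairings are invariant. *)
Lemma rotated_lower_bound (k F00 F01 F11 eta x0 x1 u0 u1 u00 u01 u11 h : R) :
  let N := u0 ^+ 2 + u1 ^+ 2 in
  let W00 := - u00 + 4^-1 * (u0 ^+ 2 - u1 ^+ 2) in
  let W11 := - u11 - 4^-1 * (u0 ^+ 2 - u1 ^+ 2) in
  let W01 := 2^-1 * (u0 * u1) - u01 in
  0 < k <= 1 -> 0 < N -> 0 < eta ->
  0 < F00 -> 0 < F00 * F11 - F01 ^+ 2 ->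
  eta * (u0 * u00 + u1 * u01) = 2 * x0 * N ->
  eta * (u0 * u01 + u1 * u11) = 2 * x1 * N ->
  2 * `|x0 * u0 + x1 * u1| <= k / 1000 * (eta * N) ->
  2 * `|x1 * u0 - x0 * u1| <= k / 1000 * (eta * N) ->
  0 < W00 + W11 ->
  0 < k ^+ 2 * (W00 * W11 - W01 ^+ 2) + (1 - k) * (W00 + W11) ^+ 2 ->
  F00 * W00 + 2 * F01 * W01 + F11 * W11 = h ->
  h <= (F00 + F11) * (k / 1000) * N ->
  (F00 + F11) * (k ^+ 2 / 512) * N ^+ 2 <=
  F00 * (u00 ^+ 2 + u01 ^+ 2) + 2 * F01 * (u01 * (u00 + u11)) + F11 * (u01 ^+ 2 + u11 ^+ 2).
Proof.
move=> N W00 W11 W01 k01 N0 eta0 F0 dF p0 p1 sx sy traceW cone euler hs.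
have Nn : u0 ^+ 2 + u1 ^+ 2 != 0 by exact: lt0r_neq0.
have en : eta != 0 by exact: lt0r_neq0.
pose al := (u0 ^+ 2 * u00 + 2 * u0 * u1 * u01 + u1 ^+ 2 * u11) / N ^+ 2.
pose de := (u1 ^+ 2 * u00 - 2 * u0 * u1 * u01 + u0 ^+ 2 * u11) / N ^+ 2.
pose be := (u0 * u1 * (u11 - u00) + (u0 ^+ 2 - u1 ^+ 2) * u01) / N ^+ 2.
pose A := (u0 ^+ 2 * F00 + 2 * u0 * u1 * F01 + u1 ^+ 2 * F11) / N.
pose C := (u1 ^+ 2 * F00 - 2 * u0 * u1 * F01 + u0 ^+ 2 * F11) / N.
pose B := (u0 * u1 * (F11 - F00) + (u0 ^+ 2 - u1 ^+ 2) * F01) / N.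
have TE : A + C = F00 + F11 by rewrite /A /C /N; field.
have dE : A * C - B ^+ 2 = F00 * F11 - F01 ^+ 2 by rewrite /A /B /C /N; field.
have F11_0 : 0 <= F11 by rewrite -(pmulr_rge0 _ F0); have := sqr_ge0 F01; lra.
have A_ge0 : 0 <= A.
  rewrite /A divr_ge0 ?(ltW N0) //.
  by have := psd_form_ge0 u0 u1 F0 (ltW dF); lra.
have A0 : 0 < A.
  rewrite lt_def A_ge0 andbT; apply/eqP => A_eq0.
  by move: dF; rewrite -dE A_eq0 mul0r sub0r oppr_gt0 ltNge sqr_ge0.
have alE : al = 2 * (x0 * u0 + x1 * u1) / (eta * N).
  have : eta * (u0 ^+ 2 * u00 + 2 * u0 * u1 * u01 + u1 ^+ 2 * u11) =
     2 * N * (x0 * u0 + x1 * u1).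
    rewrite (_ : _ * _ = eta * (u0 * u00 + u1 * u01) * u0 + eta * (u0 * u01 + u1 * u11) * u1); last by ring.
    by rewrite p0 p1; ring.
  by rewrite /al => E; apply: (mulfI en); rewrite mulrA E /N; field; rewrite en Nn.
have beE : be = 2 * (x1 * u0 - x0 * u1) / (eta * N).
  have : eta * (u0 * u1 * (u11 - u00) + (u0 ^+ 2 - u1 ^+ 2) * u01) =
     2 * N * (x1 * u0 - x0 * u1).
    rewrite (_ : _ * _ = eta * (u0 * u01 + u1 * u11) * u0 - eta * (u0 * u00 + u1 * u01) * u1); last by ring.
    by rewrite p0 p1; ring.
  by rewrite /be => E; apply: (mulfI en); rewrite mulrA E /N; field; rewrite en Nn.
have eN : 0 < eta * N by rewrite mulr_gt0.
have al_s : `|al| <= k / 1000.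
  by rewrite alE normrM normfV (gtr0_norm eN) normrM (ger0_norm (ler0n R 2)) ler_pdivrMr.
have be_s : `|be| <= k / 1000.
  by rewrite beE normrM normfV (gtr0_norm eN) normrM (ger0_norm (ler0n R 2)) ler_pdivrMr.
have trE : - al - de = (W00 + W11) / N by rewrite /al /de /W00 /W11 /N; field.
have detE : (4^-1 - al) * (- de - 4^-1) - be ^+ 2 = (W00 * W11 - W01 ^+ 2) / N ^+ 2.
  by rewrite /al /de /be /W00 /W11 /W01 /N; field.
have tr0 : 0 < - al - de by rewrite trE divr_gt0.
have cone' : 0 < k ^+ 2 * ((4^-1 - al) * (- de - 4^-1) - be ^+ 2) + (1 - k) * (al + de) ^+ 2.
  rewrite detE (_ : (al + de) ^+ 2 = (W00 + W11) ^+ 2 / N ^+ 2); last first.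
    by rewrite -(sqrrN (al + de)) opprD trE expr_div_n.
  have dist (a b c d n : R) : a * (b / n) + c * (d / n) = (a * b + c * d) / n by ring.
  by rewrite dist; exact: (divr_gt0 cone (exprn_gt0 2 N0)).
have euler' : A * (4^-1 - al) + 2 * B * (- be) + C * (- de - 4^-1) = h / N.
  by rewrite -euler /A /B /C /al /be /de /W00 /W11 /W01 /N; field.
have hs' : h / N <= (A + C) * (k / 1000) by rewrite ler_pdivrMr // TE.
have FD : (A * (al ^+ 2 + be ^+ 2) + 2 * B * (be * (al + de)) + C * (be ^+ 2 + de ^+ 2)) * N ^+ 2 =
  F00 * (u00 ^+ 2 + u01 ^+ 2) + 2 * F01 * (u01 * (u00 + u11)) + F11 * (u01 ^+ 2 + u11 ^+ 2).
  by rewrite /A /B /C /al /be /de /N; field.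
rewrite -FD -TE; apply: ler_wpM2r; first exact: sqr_ge0.
apply: (trace_form_lower_bound k01 A0 _ al_s be_s tr0 cone' euler' hs').
by rewrite dE ltW.
Qed.

(** If [W = s I], the diagonal entry in the direction of [du] gives
    [s] close to [N / 4], while Euler's relation gives [s (f0 + f1) = h],
    which is far smaller. *)
Lemma umbilic_excluded (k f0 f1 eta x0 x1 u0 u1 u00 u01 u11 h : R) :
  let N := u0 ^+ 2 + u1 ^+ 2 in
  0 < k <= 1 -> 0 < N -> 0 < eta -> 0 < f0 + f1 ->
  eta * (u0 * u00 + u1 * u01) = 2 * x0 * N ->
  eta * (u0 * u01 + u1 * u11) = 2 * x1 * N ->
  2 * `|x0 * u0 + x1 * u1| <= k / 1000 * (eta * N) ->
  2^-1 * (u11 - u00) + 4^-1 * (u0 ^+ 2 - u1 ^+ 2) = 0 ->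
  2^-1 * (u0 * u1) - u01 = 0 ->
  2^-1 * (- (u00 + u11)) * (f0 + f1) = h ->
  h <= (f0 + f1) * (k / 1000) * N -> False.
Proof.
move=> N /andP[k0 k1] N0 eta0 T0 p0 p1 sx P0 Q0 euler hs.
have q : eta * (u0 ^+ 2 * u00 + 2 * u0 * u1 * u01 + u1 ^+ 2 * u11) =
     2 * N * (x0 * u0 + x1 * u1).
  rewrite (_ : _ * _ = eta * (u0 * u00 + u1 * u01) * u0 + eta * (u0 * u01 + u1 * u11) * u1); last by ring.
  by rewrite p0 p1; ring.
pose s := 2^-1 * (- (u00 + u11)).
have u01E : u01 = 2^-1 * (u0 * u1) by lra.
have u00E : u00 = - s + 4^-1 * (u0 ^+ 2 - u1 ^+ 2) by rewrite /s; lra.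
have u11E : u11 = - s - 4^-1 * (u0 ^+ 2 - u1 ^+ 2) by rewrite /s; lra.
have q2 : eta * (N * (4^-1 * N - s)) = 2 * N * (x0 * u0 + x1 * u1).
  by rewrite -q u01E u00E u11E /N; field.
have q3 : eta * (4^-1 * N - s) = 2 * (x0 * u0 + x1 * u1).
  by apply: (mulfI (lt0r_neq0 N0)); rewrite mulrCA q2; ring.
have s1 : s <= k / 1000 * N.
  have sh : (f0 + f1) * s = h by rewrite mulrC.
  by rewrite -(ler_pM2l T0) sh mulrA.
have : eta * (4^-1 * N - s) <= k / 1000 * (eta * N).
  rewrite q3; apply: le_trans sx; apply: ler_wpM2l => //; exact: ler_norm.
have : eta * (4^-1 * N - k / 1000 * N) <= eta * (4^-1 * N - s).
  by apply: ler_wpM2l; [exact: ltW|lra].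
have := mulr_gt0 eta0 N0; nra.
Qed.

(** After multiplication by [eta^2] the left-hand side is of order 4 in
    [y = g eta] and, since [y > 1], the right-hand side is at most
    [T y^3] times the bracket in the conclusion. *)
Lemma growth_contradiction (k T N g eta r Em de : R) :
  0 < k <= 1 -> 0 < de <= T -> 0 < eta <= r ^+ 2 -> 0 < r -> 0 <= Em -> 0 <= g -> N = g ^+ 2 ->
  T * (k ^+ 2 / 512) * N ^+ 2 * eta ^+ 2 <=
    14 * r ^+ 2 * N * T + 3 * r * T * g * N * eta + eta ^+ 2 * (Em * (g + N)) ->
  1 < g * eta ->
  g * eta <= 512 / k ^+ 2 * (14 * r ^+ 2 + 3 * r + Em / de * (r ^+ 6 + r ^+ 4)).
Proof.
move=> /andP[k0 k1] /andP[de0 deT] /andP[eta0 etar] r0 Em0 g0 -> H y1.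
pose y := g * eta.
have y0 : 0 < y by rewrite /y; lra.
have T0 : 0 < T by lra.
have EmT : Em <= Em / de * T by rewrite -mulrA ler_peMr // mulrC ler_pdivlMr // mul1r.
have e2 : eta ^+ 2 <= r ^+ 4 by rewrite (exprM r 2 2) lerXn2r ?nnegrE ?exprn_ge0 // ltW.
have e3 : eta ^+ 3 <= r ^+ 6 by rewrite (exprM r 2 3) lerXn2r ?nnegrE ?exprn_ge0 // ltW.
have y13 : y <= y ^+ 3 by rewrite -[leLHS]expr1 ler_eXn2l // /y ltW.
have y23 : y ^+ 2 <= y ^+ 3 by rewrite ler_eXn2l // /y ltW.
set Q := 14 * r ^+ 2 + _ + _.
have main : T * (k ^+ 2 / 512) * y ^+ 4 <= T * (Q * y ^+ 3).
  have H2 := ler_wpM2r (sqr_ge0 eta) H.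
  have EQ1 : T * (k ^+ 2 / 512) * y ^+ 4 = T * (k ^+ 2 / 512) * (g ^+ 2) ^+ 2 * eta ^+ 2 * eta ^+ 2.
    by rewrite /y; ring.
  rewrite EQ1; apply: le_trans H2 _.
  have -> : (14 * r ^+ 2 * g ^+ 2 * T + 3 * r * T * g * g ^+ 2 * eta +
     eta ^+ 2 * (Em * (g + g ^+ 2))) * eta ^+ 2 =
     14 * r ^+ 2 * T * y ^+ 2 + 3 * r * T * y ^+ 3 + Em * (y * eta ^+ 3 + y ^+ 2 * eta ^+ 2).
    by rewrite /y; ring.
  have -> : T * (Q * y ^+ 3) = 14 * r ^+ 2 * T * y ^+ 3 + 3 * r * T * y ^+ 3
     + Em / de * T * (y ^+ 3 * r ^+ 6 + y ^+ 3 * r ^+ 4) by rewrite /Q; ring.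
  apply: lerD; first apply: lerD => //.
    by apply: ler_wpM2l => //; rewrite !mulr_ge0 ?sqr_ge0 // ltW.
  apply: ler_pM => //.
    by rewrite addr_ge0 // mulr_ge0 ?exprn_ge0 // ltW.
  by apply: lerD; apply: ler_pM => //; rewrite ?exprn_ge0 // ltW.
have c0 : 0 < k ^+ 2 / 512 by have := exprn_gt0 2 k0; lra.
have : k ^+ 2 / 512 * y <= Q.
  rewrite -(ler_pM2r (exprn_gt0 3 y0)) -(ler_pM2l T0); apply: le_trans main.
  by rewrite le_eqVlt; apply/orP; left; apply/eqP; ring.
by rewrite -ler_pdivlMl // invf_div.
Qed.

End LowerBound.

(** * The algebra of the gradient bound at a maximum *)

Section ScalarBound.
Variable R : realType.

(** A bound for [eta |du|]; [k] is [p - 1] and [Em] bounds [K e^u].  Once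
    [eta |du|] exceeds the second summand, the second derivatives in the
    direction of [du] are small against [|du|^2]; once it exceeds [1] and the
    third one, so is [K e^u]; the last summand comes from
    [growth_contradiction]. *)
Definition gradient_scale (k de r Em : R) : R :=
  1 + 2000 * r / k + 1000 * Em * r ^+ 4 / (k * de) +
  512 / k ^+ 2 * (14 * r ^+ 2 + 3 * r + Em / de * (r ^+ 6 + r ^+ 4)).

Lemma gradient_scale_ge0 (k de r Em : R) : 0 < k -> 0 < de -> 0 < r -> 0 <= Em ->
  [/\ 0 <= 2000 * r / k, 0 <= 1000 * Em * r ^+ 4 / (k * de) &
      0 <= 512 / k ^+ 2 * (14 * r ^+ 2 + 3 * r + Em / de * (r ^+ 6 + r ^+ 4))].
Proof.
move=> k0 de0 r0 Em0; have rge := ltW r0.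
set c := 14 * r ^+ 2 + 3 * r + Em / de * (r ^+ 6 + r ^+ 4).
have kd : 0 < k * de by rewrite mulr_gt0.
have c_ge0 : 0 <= c.
  have := mulr_ge0 (divr_ge0 Em0 (ltW de0)) (addr_ge0 (exprn_ge0 6 rge) (exprn_ge0 4 rge)).
  by have := exprn_ge0 2 rge; rewrite /c; lra.
split.
- by have := divr_ge0 rge (ltW k0); lra.
- by have := divr_ge0 (mulr_ge0 Em0 (exprn_ge0 4 rge)) (ltW kd); lra.
- by have := divr_ge0 c_ge0 (sqr_ge0 k); lra.
Qed.

(** [F00], [F01], [F11] are the derivatives of [f (t / 2 + S, t / 2 - S)], where
    [S = sqrt (P^2 + Q^2)], with respect to the entries of the symmetric matrix
    with trace [t], half difference [P] of the diagonal and off-diagonal entry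
    [Q].  The eigenvalues of this [F] are [f0] and [f1]. *)
Lemma linearized_form (f0 f1 P Q S : R) : 0 < f0 -> 0 < f1 -> 0 < S -> S ^+ 2 = P ^+ 2 + Q ^+ 2 ->
  let th := (f0 - f1) / (2 * S) in
  let F00 := 2^-1 * (f0 + f1) + th * P in
  let F11 := 2^-1 * (f0 + f1) - th * P in
  let F01 := th * Q in
  [/\ F00 + F11 = f0 + f1, F00 * F11 - F01 ^+ 2 = f0 * f1 & 0 < F00].
Proof.
move=> f00 f10 S0 S2 th F00 F11 F01.
have TE : F00 + F11 = f0 + f1 by rewrite /F00 /F11; field.
have dE : F00 * F11 - F01 ^+ 2 = f0 * f1.
  have -> : F00 * F11 - F01 ^+ 2 = 4^-1 * (f0 + f1) ^+ 2 - th ^+ 2 * (P ^+ 2 + Q ^+ 2).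
    by rewrite /F00 /F11 /F01; field.
  by rewrite -S2 /th; field; exact: lt0r_neq0.
split => //; rewrite ltNge; apply/negP => F0.
have := mulr_gt0 f00 f10; rewrite -dE => d0.
have F110 : 0 <= F11 by lra.
have := mulr_le0_ge0 F0 F110; have := sqr_ge0 F01; lra.
Qed.

(** Everything that happens at the maximum point, as a statement on the numbers
    [x], [du], [D^2 u], [D^3 u] and the values of [f]: [h] is [K e^u], and
    [h0], [h1] are its partial derivatives.  The differentiated equations are
    available only for distinct eigenvalues, so that [0 < S] has to be
    established first. *)
Lemma bernstein_core (k de r Em x0 x1 u0 u1 u00 u01 u11 u000 u001 u011 u111 f0 f1
    eta g h h0 h1 : R) :
  let N := u0 ^+ 2 + u1 ^+ 2 in
  let t := - (u00 + u11) in
  let P := 2^-1 * (u11 - u00) + 4^-1 * (u0 ^+ 2 - u1 ^+ 2) in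
  let Q := 2^-1 * (u0 * u1) - u01 in
  let S := Num.sqrt (P ^+ 2 + Q ^+ 2) in
  0 < k <= 1 -> 0 < de -> 0 < r -> 0 <= Em ->
  0 < f0 -> 0 < f1 -> de <= f0 + f1 ->
  0 <= g -> g ^+ 2 = N -> x0 ^+ 2 + x1 ^+ 2 <= r ^+ 2 -> 0 < eta <= r ^+ 2 ->
  eta * (u0 * u00 + u1 * u01) = 2 * x0 * N ->
  eta * (u0 * u01 + u1 * u11) = 2 * x1 * N ->
  (forall a b : R,
    eta ^+ 2 * ((a * u00 + b * u01) ^+ 2 + (a * u01 + b * u11) ^+ 2
      + u0 * (a * (a * u000 + b * u001) + b * (a * u001 + b * u011))
      + u1 * (a * (a * u001 + b * u011) + b * (a * u011 + b * u111)))
    - 12 * (a * x0 + b * x1) ^+ 2 * N - 2 * eta * (a ^+ 2 + b ^+ 2) * N <= 0) ->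
  (2^-1 * t + S) * f0 + (2^-1 * t - S) * f1 = h -> h <= Em ->
  0 < t -> 0 < k ^+ 2 * ((2^-1 * t + S) * (2^-1 * t - S)) + (1 - k) * t ^+ 2 ->
  (0 < S -> 2^-1 * (f0 + f1) * (- (u000 + u011)) + (f0 - f1) *
    ((P * (2^-1 * (u011 - u000) + 4^-1 * (2 * (u0 * u00) - 2 * (u1 * u01)))
    + Q * (2^-1 * (u0 * u01 + u1 * u00) - u001)) / S) = h0) ->
  (0 < S -> 2^-1 * (f0 + f1) * (- (u001 + u111)) + (f0 - f1) *
    ((P * (2^-1 * (u111 - u001) + 4^-1 * (2 * (u0 * u01) - 2 * (u1 * u11)))
    + Q * (2^-1 * (u0 * u11 + u1 * u01) - u011)) / S) = h1) ->
  h0 * u0 + h1 * u1 <= Em * (g + g ^+ 2) ->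
  g * eta <= gradient_scale k de r Em.
Proof.
move=> N t P Q S k01 de0 r0 Em0 f00 f10 deT g0 gN xr /andP[eta0 etar] p0 p1 q
  euler hEm t0 cone eq0 eq1 hu.
have [k0 k1] := andP k01.
set L := gradient_scale _ _ _ _; rewrite leNgt; apply/negP => yL.
set c := 14 * r ^+ 2 + 3 * r + Em / de * (r ^+ 6 + r ^+ 4).
have rge := ltW r0.
have kd : 0 < k * de by rewrite mulr_gt0.
have [l1 l2 l3] := gradient_scale_ge0 k0 de0 r0 Em0; rewrite -/c in l3.
have LE : L = 1 + 2000 * r / k + 1000 * Em * r ^+ 4 / (k * de) + 512 / k ^+ 2 * c by [].
have T0 : 0 < f0 + f1 by exact: addr_gt0.
have y1 : 1 < g * eta by clear -yL LE l1 l2 l3; lra.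
have g_gt0 : 0 < g.
  by rewrite lt_def g0 andbT; apply/eqP => g00; move: y1; rewrite g00 mul0r ltr10.
have N0 : 0 < N by rewrite -gN exprn_gt0.
have yk : 2 * r <= k / 1000 * (g * eta).
  have yr : 2000 * r / k <= g * eta by clear -yL LE l1 l2 l3; lra.
  have := ler_wpM2l (ltW k0) yr.
  rewrite (_ : k * (2000 * r / k) = 2000 * r); first by move=> h'; clear -h'; lra.
  by field; exact: lt0r_neq0.
have uN : u0 ^+ 2 + u1 ^+ 2 <= g ^+ 2 by rewrite gN.
have small (a : R) : `|a| <= r * g -> 2 * `|a| <= k / 1000 * (eta * N).
  move=> a_s; rewrite -gN (_ : k / 1000 * (eta * g ^+ 2) = k / 1000 * (g * eta) * g); last by ring.
  apply: le_trans (_ : 2 * r * g <= _); last exact: ler_wpM2r.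
  by rewrite -mulrA ler_wpM2l.
have sx := small _ (dot_bound rge g0 xr uN).
(* the vector (x1, - x0) is as long as x *)
have sy : 2 * `|x1 * u0 - x0 * u1| <= k / 1000 * (eta * N).
  apply: small; have := @dot_bound R x1 (- x0) u0 u1 r g rge g0.
  by rewrite mulNr sqrrN addrC => /(_ xr uN).
have hs : h <= (f0 + f1) * (k / 1000) * N.
  apply: (le_trans hEm).
  have e4 : eta ^+ 2 <= r ^+ 4 by rewrite (exprM r 2 2) lerXn2r ?nnegrE ?exprn_ge0 // ltW.
  have yy : 1000 * Em * r ^+ 4 / (k * de) <= (g * eta) ^+ 2.
    apply: (@le_trans _ _ (g * eta)); first by clear -yL LE l1 l2 l3; lra.
    by rewrite expr2 ler_peMr // ltW // (lt_trans ltr01).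
  have r40 : 0 < r ^+ 4 by rewrite exprn_gt0.
  rewrite (ler_pdivrMr _ _ kd) in yy.
  have : 1000 * Em * r ^+ 4 <= N * (k * de) * r ^+ 4.
    apply: (le_trans yy).
    rewrite (_ : (g * eta) ^+ 2 * _ = N * (k * de) * eta ^+ 2); last by rewrite -gN; ring.
    by apply: ler_wpM2l e4; exact: (mulr_ge0 (ltW N0) (ltW kd)).
  rewrite (ler_pM2r r40) => H.
  have H2 : N * (k * de) <= N * (k * (f0 + f1)) by rewrite !ler_pM2l.
  clear -H H2; lra.
have S_ge0 : 0 <= S by exact: sqrtr_ge0.
have S2 : S ^+ 2 = P ^+ 2 + Q ^+ 2 by rewrite sqr_sqrtr // addr_ge0 ?sqr_ge0.
have S0 : 0 < S.
  rewrite lt_def S_ge0 andbT; apply/eqP => S00.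
  have PQ : P ^+ 2 + Q ^+ 2 = 0 by rewrite -S2 S00 expr0n.
  have /eqP := PQ; rewrite paddr_eq0 ?sqr_ge0 // !sqrf_eq0 => /andP[/eqP P0 /eqP Q0].
  apply: (umbilic_excluded k01 N0 eta0 T0 p0 p1 sx P0 Q0 _ hs).
  by rewrite -euler S00 /t; ring.
have [TE dE F0] := linearized_form f00 f10 S0 S2.
move: TE dE F0; set th := (f0 - f1) / (2 * S).
set F00 := _ + th * P; set F11 := _ - th * P; set F01 := th * Q => TE dE F0.
have dF : 0 < F00 * F11 - F01 ^+ 2 by rewrite dE mulr_gt0.
have Sn : S != 0 by exact: lt0r_neq0.
have E0 : F00 * (- u000 + 2^-1 * (u0 * u00 - u1 * u01)) + 2 * F01 * (- u001 + 2^-1 * (u00 * u1 + u0 * u01))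
    + F11 * (- u011 - 2^-1 * (u0 * u00 - u1 * u01)) = h0.
  rewrite -(eq0 S0) /F00 /F01 /F11 /th; move: (P) (Q) (S) Sn => P' Q' S' Sn'.
  by field.
have E1 : F00 * (- u001 + 2^-1 * (u0 * u01 - u1 * u11)) + 2 * F01 * (- u011 + 2^-1 * (u01 * u1 + u0 * u11))
    + F11 * (- u111 - 2^-1 * (u0 * u01 - u1 * u11)) = h1.
  rewrite -(eq1 S0) /F00 /F01 /F11 /th; move: (P) (Q) (S) Sn => P' Q' S' Sn'.
  by field.
have upper := contracted_inequality F0 (ltW dF) p0 p1 E0 E1 q.
set FD := F00 * (u00 ^+ 2 + u01 ^+ 2) + 2 * F01 * (u01 * (u00 + u11)) + F11 * (u01 ^+ 2 + u11 ^+ 2) in upper *.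
have lower : (F00 + F11) * (k ^+ 2 / 512) * N ^+ 2 <= FD.
  apply: (rotated_lower_bound k01 N0 eta0 F0 dF p0 p1 sx sy (h := h)).
  - by rewrite (_ : _ + _ = t) // /t; ring.
  - rewrite (_ : - u00 + _ + _ = t); last by rewrite /t; ring.
    move: cone; congr (0 < k ^+ 2 * _ + _).
    rewrite (_ : (2^-1 * t + S) * (2^-1 * t - S) = 4^-1 * t ^+ 2 - S ^+ 2); last by field.
    by rewrite S2 /t /P /Q; field.
  - rewrite -euler.
    have -> : (2^-1 * t + S) * f0 + (2^-1 * t - S) * f1 =
      2^-1 * (f0 + f1) * t + 2 * th * S ^+ 2 by rewrite /th; field.
    by rewrite S2 /F00 /F01 /F11 /t /P /Q; field.
  - by rewrite TE.
have bxx : F00 * x0 ^+ 2 + 2 * F01 * x0 * x1 + F11 * x1 ^+ 2 <= (f0 + f1) * r ^+ 2.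
  have := psd_form_ge0 x1 (- x0) F0 (ltW dF); have := ler_wpM2l (ltW T0) xr.
  by rewrite -TE => h1' h2'; clear -h1' h2'; lra.
have := cauchy_schwarz_form F0 (ltW dF) rge g0 xr uN; rewrite TE.
set FX := F00 * x0 * u0 + _ + _ => /ler_normlP[bxu _].
have /ler_normlP[_ bx] := dot_bound rge g0 xr uN.
have fin : (f0 + f1) * (k ^+ 2 / 512) * N ^+ 2 * eta ^+ 2 <=
    14 * r ^+ 2 * N * (f0 + f1) + 3 * r * (f0 + f1) * g * N * eta + eta ^+ 2 * (Em * (g + N)).
  rewrite -/FX TE in upper; rewrite TE in lower.
  have low2 := ler_wpM2l (sqr_ge0 eta) lower.
  rewrite mulrC; apply: (le_trans low2); apply: (le_trans upper).
  have b1 : 12 * N * (F00 * x0 ^+ 2 + 2 * F01 * x0 * x1 + F11 * x1 ^+ 2) <= 12 * N * ((f0 + f1) * r ^+ 2).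
    by apply: ler_wpM2l => //; rewrite mulr_ge0 // ltW.
  have b2 : 2 * eta * N * (f0 + f1) <= 2 * r ^+ 2 * N * (f0 + f1).
    by do 2 (apply: ler_wpM2r; first exact: ltW); apply: ler_wpM2l.
  have Ne : 0 <= N * eta by rewrite mulr_ge0 // ltW.
  have b3 : 2 * (N * eta) * (- FX) <= 2 * (N * eta) * ((f0 + f1) * r * g).
    by apply: ler_wpM2l => //; exact: mulr_ge0.
  have b4 : N * eta * (f0 + f1) * (x0 * u0 + x1 * u1) <= N * eta * (f0 + f1) * (r * g).
    by apply: ler_wpM2l => //; rewrite mulr_ge0 // ltW.
  have b5 : eta ^+ 2 * (h0 * u0 + h1 * u1) <= eta ^+ 2 * (Em * (g + N)).
    by rewrite -gN; apply: ler_wpM2l hu; exact: sqr_ge0.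
  clear -b1 b2 b3 b4 b5; lra.
have etr : 0 < eta <= r ^+ 2 by rewrite eta0.
have deT' : 0 < de <= f0 + f1 by rewrite de0.
have := growth_contradiction k01 deT' etr r0 Em0 g0 (esym gN) fin y1.
by rewrite -/c => yc; clear -yc yL LE l1 l2 l3; lra.
Qed.

End ScalarBound.

(** * The interior estimate *)

Section MaximumBound.
Variable R : realType.
Implicit Types (D : set 'rV[R]_2) (f g u K : 'rV[R]_2 -> R) (x v w l : 'rV[R]_2).

Notation ex := (delta_mx 0 0 : 'rV[R]_2).
Notation ey := (delta_mx 0 1 : 'rV[R]_2).

#[local] Opaque partial.

(** The transfer from functions to the numbers in [bernstein_core], for which
    all third derivatives of [u] have to be brought to a common order of
    differentiation. *)
Lemma interior_max_bound D (p : R) f K u x (delta r rho Mu MK : R) :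
  1 < p <= 2 -> classC 1 (Gamma p) f ->
  (forall (t : R) l, 0 < t -> closure (Gamma p) l -> f (t *: l) = t * f l) ->
  (forall i l, Gamma p l -> 0 < partial i f l) ->
  0 < delta -> (forall l, Gamma p l -> delta <= \sum_i partial i f l) ->
  0 < r -> open D -> classC 3 D u -> classC 1 D K -> D x ->
  (forall y, D y -> Gamma p (eigW u y) /\ f (eigW u y) = expR (u y) * K y) ->
  0 < K x -> K x <= MK -> enorm (grad K x) <= MK -> u x <= Mu ->
  let eta (y : 'rV[R]_2) := rho ^+ 2 - (y 0 0 ^+ 2 + y 0 1 ^+ 2) in
  let N (y : 'rV[R]_2) := partial 0 u y ^+ 2 + partial 1 u y ^+ 2 in
  x 0 0 ^+ 2 + x 0 1 ^+ 2 <= r ^+ 2 -> 0 < eta x <= r ^+ 2 ->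
  (forall y, D y -> eta y ^+ 2 * N y <= eta x ^+ 2 * N x) ->
  enorm (grad u x) * eta x <= gradient_scale (p - 1) delta r (expR Mu * MK).
Proof.
move=> hp.
have k01 : 0 < p - 1 <= 1 by case/andP: hp => ? ?; apply/andP; split; lra.
move=> fC f_hom df_gt0 de0 df_sum r0 oD uC3 KC Dx eqn K0 KMK dKMK uMu eta N xr etar max.
have [uC0 uC] := uC3.
have [Glam flam] := eqn x Dx.
have p2 : p <= 2 by case/andP: hp.
have C2 k : classC 2 D (partial k u) by have [] := uC k.
have sym y : D y -> partial 1 (partial 0 u) y = partial 0 (partial 1 u) y.
  by move=> Dy; exact: esym (partial_comm oD (classCS uC3) Dy).
have nsym i : partial i (partial 1 (partial 0 u)) x = partial i (partial 0 (partial 1 u)) x.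
  exact: near_eq_partial oD Dx sym.
have s100 : partial 1 (partial 0 (partial 0 u)) x = partial 0 (partial 0 (partial 1 u)) x.
  have h := esym (partial_comm oD (C2 0) Dx); have n0 := nsym 0.
  by apply: etrans h _; exact: n0.
have s101 : partial 1 (partial 0 (partial 1 u)) x = partial 0 (partial 1 (partial 1 u)) x.
  by have h := partial_comm oD (C2 1) Dx; exact: esym h.
have s110 : partial 1 (partial 1 (partial 0 u)) x = partial 0 (partial 1 (partial 1 u)) x.
  by have n1 := nsym 1; apply: etrans n1 _; exact: s101.
have eta0 : 0 < eta x by case/andP: etar.
have mx v := max_point_conditions oD uC3 Dx eta0 max v.
have gradE g : enorm (grad g x) ^+ 2 = partial 0 g x ^+ 2 + partial 1 g x ^+ 2.
  by rewrite sqr_enorm !mxE.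
have g_ge0 g : 0 <= enorm (grad g x) by rewrite /enorm sqrtr_ge0.
have MK0 : 0 < MK by exact: lt_le_trans K0 KMK.
have Em0 : 0 <= expR Mu * MK by exact: mulr_ge0 (expR_ge0 _) (ltW MK0).
have euE : expR (u x) <= expR Mu by rewrite ler_expR.
have eu0 := expR_gt0 (u x).
have [tr_gt0 cone] := cone_inequality Glam p2.
have euler := euler_relation fC f_hom Glam.
rewrite flam !vec2_0 !vec2_1 in euler; rewrite !vec2_0 !vec2_1 in tr_gt0 cone.
have trE (t s : R) : (2^-1 * t + s) + (2^-1 * t - s) = t by field.
rewrite !trE in tr_gt0 cone.
have first (a b : R) : eta x * (partial 0 u x * (a * partial 0 (partial 0 u) x + b * partial 0 (partial 1 u) x)
     + partial 1 u x * (a * partial 0 (partial 1 u) x + b * partial 1 (partial 1 u) x)) =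
     2 * (a * x 0 0 + b * x 0 1) * N x.
  by have [+ _] := mx (a *: ex + b *: ey); rewrite /= !vec2_0 !vec2_1 (sym x Dx).
have subst5 (w10 w100 w010 w110 w101 z10 z100 z010 z110 z101 : R) (Phi : R -> R -> R -> R -> R -> Prop) :
    w10 = z10 -> w100 = z100 -> w010 = z010 -> w110 = z110 -> w101 = z101 ->
    Phi w10 w100 w010 w110 w101 -> Phi z10 z100 z010 z110 z101.
  by move=> -> -> -> -> ->.
have subst3 (w10 w100 w101 z10 z100 z101 : R) (Phi : R -> R -> R -> Prop) :
    w10 = z10 -> w100 = z100 -> w101 = z101 -> Phi w10 w100 w101 -> Phi z10 z100 z101.
  by move=> -> -> ->.
have along0 (e v0 v1 a b c d X Y n : R) :
    e * (v0 * (1 * a + 0 * b) + v1 * (1 * c + 0 * d)) = 2 * (1 * X + 0 * Y) * n ->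
    e * (v0 * a + v1 * c) = 2 * X * n by rewrite !mul1r !mul0r !addr0.
have along1 (e v0 v1 a b c d X Y n : R) :
    e * (v0 * (0 * a + 1 * b) + v1 * (0 * c + 1 * d)) = 2 * (0 * X + 1 * Y) * n ->
    e * (v0 * b + v1 * d) = 2 * Y * n by rewrite !mul1r !mul0r !add0r.
have eq_k k := derivative_of_equation k oD uC3 KC fC eqn Dx.
apply: (@bernstein_core R (p - 1) delta r (expR Mu * MK) (x 0 0) (x 0 1)
  (partial 0 u x) (partial 1 u x) (partial 0 (partial 0 u) x) (partial 0 (partial 1 u) x)
  (partial 1 (partial 1 u) x)
  (partial 0 (partial 0 (partial 0 u)) x) (partial 0 (partial 0 (partial 1 u)) x)
  (partial 0 (partial 1 (partial 1 u)) x) (partial 1 (partial 1 (partial 1 u)) x)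
  (partial 0 f (eigW u x)) (partial 1 f (eigW u x))
  (eta x) (enorm (grad u x)) (expR (u x) * K x)
  (expR (u x) * (partial 0 K x + K x * partial 0 u x))
  (expR (u x) * (partial 1 K x + K x * partial 1 u x)) k01 de0 r0 Em0).
- exact: df_gt0.
- exact: df_gt0.
- by have := df_sum _ Glam; rewrite sum2.
- exact: g_ge0.
- exact: gradE.
- exact: xr.
- exact: etar.
- exact: (along0 _ _ _ _ _ _ _ _ _ _ (first 1 0)).
- exact: (along1 _ _ _ _ _ _ _ _ _ _ (first 0 1)).
- move=> a b.
  (* Phi isolates the derivatives whose order is exchanged *)
  pose Phi (w10 w100 w010 w110 w101 : R) := eta x ^+ 2 *
    ((a * partial 0 (partial 0 u) x + b * w10) ^+ 2 +
     (a * partial 0 (partial 1 u) x + b * partial 1 (partial 1 u) x) ^+ 2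
     + partial 0 u x * (a * (a * partial 0 (partial 0 (partial 0 u)) x + b * w100)
        + b * (a * w010 + b * w110))
     + partial 1 u x * (a * (a * partial 0 (partial 0 (partial 1 u)) x + b * w101)
        + b * (a * partial 0 (partial 1 (partial 1 u)) x
               + b * partial 1 (partial 1 (partial 1 u)) x)))
    - 12 * (a * x 0 0 + b * x 0 1) ^+ 2 * N x - 2 * eta x * (a ^+ 2 + b ^+ 2) * N x <= 0.
  have P0 : Phi (partial 1 (partial 0 u) x) (partial 1 (partial 0 (partial 0 u)) x)
     (partial 0 (partial 1 (partial 0 u)) x) (partial 1 (partial 1 (partial 0 u)) x)
     (partial 1 (partial 0 (partial 1 u)) x).
    by have [_] := mx (a *: ex + b *: ey); rewrite vec2_0 vec2_1.
  have n0 := nsym 0; have sx := sym x Dx.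
  exact: (subst5 _ _ _ _ _ _ _ _ _ _ Phi sx s100 n0 s110 s101 P0).
- exact: euler.
- exact: (ler_pM (ltW eu0) (ltW K0) euE KMK).
- exact: tr_gt0.
- exact: cone.
- exact: (eq_k 0).
- move=> S0; have := eq_k 1 S0 => /=.
  pose Phi (w10 w100 w101 : R) :=
    2^-1 * (partial 0 f (eigW u x) + partial 1 f (eigW u x)) *
      (- (w100 + partial 1 (partial 1 (partial 1 u)) x)) +
    (partial 0 f (eigW u x) - partial 1 f (eigW u x)) *
    ((diffW u x * (2^-1 * (partial 1 (partial 1 (partial 1 u)) x - w100)
        + 4^-1 * (2 * (partial 0 u x * w10) - 2 * (partial 1 u x * partial 1 (partial 1 u) x)))
    + offW u x * (2^-1 * (partial 0 u x * partial 1 (partial 1 u) x + partial 1 u x * w10) - w101))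
    / gapW u x) = expR (u x) * (partial 1 K x + K x * partial 1 u x).
  by move=> P0; have sx := sym x Dx; exact: (subst3 _ _ _ _ _ _ Phi sx s100 s101 P0).
have alg (e K' g0' g1' v0 v1 n : R) : n = v0 ^+ 2 + v1 ^+ 2 ->
    e * (g0' + K' * v0) * v0 + e * (g1' + K' * v1) * v1 = e * (g0' * v0 + g1' * v1 + K' * n).
  by move=> ->; ring.
have gK : partial 0 K x ^+ 2 + partial 1 K x ^+ 2 <= MK ^+ 2.
  have gK2 : enorm (grad K x) ^+ 2 <= MK ^+ 2.
    by apply: (lerXn2r 2 _ _ dKMK); rewrite nnegrE; [exact: g_ge0|exact: ltW].
  by move: gK2; rewrite (gradE K).
have gu : partial 0 u x ^+ 2 + partial 1 u x ^+ 2 <= enorm (grad u x) ^+ 2 by rewrite (gradE u).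
have /ler_normlP[_ dKu] := dot_bound (ltW MK0) (g_ge0 u) gK gu.
rewrite (alg _ _ _ _ _ _ _ (gradE u)); move: dKu (g_ge0 u) => dKu gu0.
apply: (@le_trans _ _ (expR (u x) * (MK * enorm (grad u x) + MK * enorm (grad u x) ^+ 2))).
  apply: ler_wpM2l; first exact: ltW.
  by apply: lerD dKu _; apply: ler_wpM2r KMK; exact: sqr_ge0.
have alg2 (e M n : R) : e * (M * n + M * n ^+ 2) = e * M * (n + n ^+ 2) by ring.
rewrite alg2; apply: (ler_wpM2r (addr_ge0 gu0 (sqr_ge0 _))).
exact: (ler_wpM2r (ltW MK0) euE).
Qed.

End MaximumBound.

Section Cutoff.
Variable R : realType.
Implicit Types (D : set 'rV[R]_2) (f g u K : 'rV[R]_2 -> R) (x v w l : 'rV[R]_2).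

Lemma sup_bound D g (M : R) x :
  (ereal_sup [set (g y)%:E | y in D] <= M%:E)%E -> D x -> g x <= M.
Proof.
move=> gM Dx; rewrite -lee_fin; apply: le_trans gM.
by apply: ereal_sup_ubound; exists x.
Qed.

Lemma normC1_bound D g (M : R) x : (normC1 D g <= M%:E)%E -> D x ->
  g x <= M /\ enorm (grad g x) <= M.
Proof.
rewrite /normC1; set S0 := ereal_sup _; set S1 := ereal_sup _ => SM Dx.
have h0 : (`|g x|%:E <= S0)%E by apply: ereal_sup_ubound; exists x.
have h1 : ((enorm (grad g x))%:E <= S1)%E by apply: ereal_sup_ubound; exists x.
have S0_ge0 : (0 <= S0)%E by apply: le_trans h0; rewrite lee_fin.
have S1_ge0 : (0 <= S1)%E by apply: le_trans h1; rewrite lee_fin sqrtr_ge0.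
split; rewrite -lee_fin.
  apply: le_trans SM; apply: le_trans (leeDl _ S1_ge0); apply: le_trans h0.
  by rewrite lee_fin ler_norm.
by apply: le_trans SM; apply: le_trans (leeDr _ S0_ge0).
Qed.

Lemma closed_disk_compact (rho : R) :
  compact [set y : 'rV[R]_2 | y 0 0 ^+ 2 + y 0 1 ^+ 2 <= rho ^+ 2].
Proof.
apply: bounded_closed_compact.
  exists `|rho|; split; first exact: num_real.
  move=> M rM y /= yrho; apply: ltW; apply: norm2_lt.
  - exact: le_lt_trans (normr_ge0 _) rM.
  - apply: le_lt_trans rM; rewrite -(sqrtr_sqr (y 0 0)) -(sqrtr_sqr rho); apply: ler_wsqrtr.
    by apply: le_trans yrho; rewrite lerDl sqr_ge0.
  - apply: le_lt_trans rM; rewrite -(sqrtr_sqr (y 0 1)) -(sqrtr_sqr rho); apply: ler_wsqrtr.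
    by apply: le_trans yrho; rewrite lerDr sqr_ge0.
have -> : [set y : 'rV[R]_2 | y 0 0 ^+ 2 + y 0 1 ^+ 2 <= rho ^+ 2] =
  (fun y : 'rV[R]_2 => y 0 0 ^+ 2 + y 0 1 ^+ 2) @^-1` [set s | s <= rho ^+ 2] by [].
by apply: closed_comp; [move=> y _; exact: continuous_sqnorm|exact: closed_le].
Qed.

Lemma continuous_weight D (rho : R) u x : classC 1 D u -> D x ->
  {for x, continuous (fun y : 'rV[R]_2 => (rho ^+ 2 - (y 0 0 ^+ 2 + y 0 1 ^+ 2)) ^+ 2 *
    (partial 0 u y ^+ 2 + partial 1 u y ^+ 2))}.
Proof.
move=> [_ uC] Dx.
have cu i : {for x, continuous (partial i u)} by have [_ [c _]] := uC i; exact: c.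
have ce : {for x, continuous (fun y : 'rV[R]_2 => rho ^+ 2 - (y 0 0 ^+ 2 + y 0 1 ^+ 2))}.
  by apply: (@continuousB R R^o 'rV[R]_2 (cst (rho ^+ 2)) _ x);
    [exact: cst_continuous|exact: continuous_sqnorm].
have sq (h : 'rV[R]_2 -> R) : {for x, continuous h} -> {for x, continuous (fun y => h y ^+ 2)}.
  by move=> ch; exact: (@continuousM R 'rV[R]_2 h h x ch ch).
have cN := @continuousD R R^o 'rV[R]_2 _ _ x (sq _ (cu 0)) (sq _ (cu 1)).
exact: (@continuousM R 'rV[R]_2 _ _ x (sq _ ce) cN).
Qed.

End Cutoff.

Theorem theorem1p11 (R : realType) (p : R) (hp : 1 < p <= 2)
  (f : 'rV[R]_2 -> R)
  (f_C1 : classC 1 (Gamma p) f)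
  (f_C0 : {within closure (Gamma p), continuous f})
  (f_sym : forall l, closure (Gamma p) l -> f (xcol 0 1 l) = f l)
  (f_hom : forall (t : R) l, 0 < t -> closure (Gamma p) l ->
     f (t *: l) = t * f l)
  (f_gt0 : forall l, Gamma p l -> 0 < f l)
  (df_gt0 : forall i l, Gamma p l -> 0 < partial i f l)
  (f_bnd : forall l, boundary (Gamma p) l -> f l = 0)
  (df_sum : exists2 delta : R, 0 < delta &
     forall l, Gamma p l -> delta <= \sum_i partial i f l)
  (r : R) (hr : 0 < r) (Mu MK : R) :
  exists C : R, forall K u : 'rV[R]_2 -> R,
    classC 1 (eball r) K ->
    (forall x, eball r x -> 0 < K x) ->
    classC 3 (eball r) u ->
    (forall x, eball r x -> exists l : 'rV[R]_2,
       [/\ eigenvalues_of (Amat u x) l, Gamma p l & f l = K x]) ->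
    (ereal_sup [set (u x)%:E | x in eball r] <= Mu%:E)%E ->
    (normC1 (eball r) K <= MK%:E)%E ->
    forall x, eball (r / 2) x -> enorm (grad u x) <= C.
Proof.
have [delta de0 df_de] := df_sum.
(* On the ball of radius r / 2 the weight is at least
   (9/16 - 1/4) r^2 = 5/16 r^2. *)
pose L := gradient_scale (p - 1) delta r (expR Mu * MK).
exists (16 / (5 * r ^+ 2) * L) => K u KC K_gt0 uC eqn uMu KMK x.
pose rho := 3 / 4 * r.
have rho0 : 0 < rho by rewrite /rho; lra.
have rho_r : rho < r by rewrite /rho; lra.
have r20 : 0 < r / 2 by lra.
have r2 : 0 < r ^+ 2 by exact: exprn_gt0.
have rhoE : rho ^+ 2 = 9 / 16 * r ^+ 2 by rewrite /rho; field.
have r2E : (r / 2) ^+ 2 = 1 / 4 * r ^+ 2 by field.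
move=> /(eball_sq _ r20); rewrite r2E => xr.
pose eta (y : 'rV[R]_2) := rho ^+ 2 - (y 0 0 ^+ 2 + y 0 1 ^+ 2).
pose N (y : 'rV[R]_2) := partial 0 u y ^+ 2 + partial 1 u y ^+ 2.
pose B := [set y : 'rV[R]_2 | y 0 0 ^+ 2 + y 0 1 ^+ 2 <= rho ^+ 2].
have Br y : B y -> eball r y.
  by rewrite /B /= => yB; apply/(eball_sq _ hr); rewrite rhoE in yB; lra.
have Bx : B x by rewrite /B /= rhoE; lra.
have sqE y : enorm (grad u y) ^+ 2 = N y by rewrite sqr_enorm !mxE.
have cG : {within B, continuous (fun y => eta y ^+ 2 * N y)}.
  apply: continuous_in_subspaceT => y; rewrite inE => /Br.
  exact: continuous_weight (classCS (classCS uC)).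
have [c cB cmax] := EVT_max_rV (ex_intro _ x Bx) (@closed_disk_compact R rho) cG.
rewrite inE in cB.
have {}cmax y : B y -> eta y ^+ 2 * N y <= eta c ^+ 2 * N c by move=> ?; apply: cmax; rewrite inE.
have cr := Br _ cB.
have [KcMK dKcMK] := normC1_bound KMK cr.
have MK0 : 0 < MK by exact: lt_le_trans (K_gt0 _ cr) KcMK.
have Em0 : 0 <= expR Mu * MK by exact: mulr_ge0 (expR_ge0 _) (ltW MK0).
have k0 : 0 < p - 1 by case/andP: hp; rewrite subr_gt0.
have L0 : 0 <= L.
  by have [? ? ?] := gradient_scale_ge0 k0 de0 hr Em0; rewrite /L /gradient_scale; lra.
have eta_ge0 : 0 <= eta c by rewrite /eta subr_ge0.
have cL : enorm (grad u c) * eta c <= L.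
  (* the maximum may lie on the boundary circle, where the weight vanishes *)
  have [ec|ec] := leP (eta c) 0.
    have -> : eta c = 0 by apply/eqP; rewrite eq_le ec eta_ge0.
    by rewrite mulr0.
  pose D : set 'rV[R]_2 := eball rho.
  have DB : D `<=` B by move=> y /(eball_sq _ rho0) /ltW.
  have Dr : D `<=` eball r by move=> y /DB/Br.
  have oD : open D by exact: eball_open.
  have Dc : D c by apply/(eball_sq _ rho0); rewrite -subr_gt0.
  have uD := classC_subset Dr uC; have KD := classC_subset Dr KC.
  apply: (interior_max_bound hp f_C1 f_hom df_gt0 de0 df_de hr oD uD KD Dc).
  - move=> y Dy; have [l [el Gl <-]] := eqn y (Dr _ Dy).
    apply: (spectral_equation f_sym f_hom _ el Gl).
    exact: (partial_comm oD (classCS uD) Dy).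
  - exact: K_gt0.
  - exact: KcMK.
  - exact: dKcMK.
  - exact: sup_bound uMu cr.
  - by move: cB; rewrite /B /= rhoE; lra.
  - apply/andP; split => //; rewrite /eta rhoE; have := sqr_ge0 (c 0 0); have := sqr_ge0 (c 0 1); lra.
  - by move=> y /DB; exact: cmax.
have ge y : 0 <= enorm (grad u y) by exact: sqrtr_ge0.
have eta_x : 5 / 16 * r ^+ 2 <= eta x by rewrite /eta rhoE; lra.
have eta_x0 : 0 <= eta x by lra.
have xL : enorm (grad u x) * eta x <= L.
  apply: le_trans cL.
  have /ler_wsqrtr := cmax x Bx.
  by rewrite -!sqE -!exprMn !sqrtr_sqr !ger0_norm ?mulr_ge0 // mulrC [leRHS]mulrC.
have -> : enorm (grad u x) = 16 / (5 * r ^+ 2) * (enorm (grad u x) * (5 / 16 * r ^+ 2)).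
  by field; exact: lt0r_neq0.
apply: ler_wpM2l; last exact: le_trans (ler_wpM2l (ge x) eta_x) xL.
by apply: divr_ge0 => //; apply: mulr_ge0 => //; exact: ltW.
Qed.
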